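(* There is an absolute constant $C>0$ such that the following holds. Let $G$ be a connected graph with $n$ vertices and maximum degree $\Delta\ge 3$, and let $L$ be a list-assignment of $G$ with $|L(v)|\ge\deg(v)+1$ for all $v\in V(G)$. Then $\widehat{\mathcal{C}}(G,L)$ is connected and has diameter at most $Cn^2$. Moreover, if $(G_k,L_k)$ is a sequence of such pairs where $G_k$ has $n_k\to\infty$ vertices and maximum degree $\Delta_k=o(n_k^{1/4})$, then the ratio of the number of frozen $L_k$-colourings of $G_k$ to the number of unfrozen $L_k$-colourings of $G_k$ tends to $0$.
   Context: A list-assignment $L$ assigns to each vertex $v$ a finite set $L(v)\subseteq\mathbb{N}$; an $L$-colouring is a proper colouring $\varphi$ with $\varphi(v)\in L(v)$ for all $v$. A recolouring step changes the colour of one vertex $v$ to another colour of $L(v)$, keeping the colouring proper. A vertex $v$ is frozen under $\varphi$ if it cannot be recoloured, i.e. every colour of $L(v)\setminus\{\varphi(v)\}$ appears on a neighbour of $v$; an $L$-colouring is frozen if all its vertices are frozen, and unfrozen otherwise. $\mathcal{C}(G,L)$ is the graph whose vertices are the $L$-colourings of $G$, adjacent when they differ by one recolouring step; $\widehat{\mathcal{C}}(G,L)$ is its subgraph induced by the unfrozen $L$-colourings. The diameter is with respect to the graph distance in $\widehat{\mathcal{C}}(G,L)$. *)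

(* Defs.v *)
From HB Require Import structures.
From mathcomp Require Import all_boot all_order all_algebra.
From mathcomp Require Import finmap.
Set Implicit Arguments. Unset Strict Implicit. Unset Printing Implicit Defensive.
Import Order.TTheory GRing.Theory Num.Theory.

Section Recolouring.
Variables (T : finType) (e : rel T).

Definition simple_graph : Prop := symmetric e /\ irreflexive e.

Definition connected_graph : Prop := forall u v : T, connect e u v.

Definition deg (v : T) : nat := #|[set u | e v u]|.

Definition maxdeg : nat := \max_(v : T) deg v.

Variable L : T -> {fset nat}.

Definition proper_col (phi : {ffun T -> nat}) : bool :=
  [forall u, forall v, e u v ==> (phi u != phi v)].

Definition Lcol (phi : {ffun T -> nat}) : bool :=
  proper_col phi && [forall v, phi v \in L v].

Definition recol_step (phi psi : {ffun T -> nat}) : bool :=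
  [&& Lcol phi, Lcol psi & #|[set v | phi v != psi v]| == 1].

Definition frozen_vertex (phi : {ffun T -> nat}) (v : T) : bool :=
  all (fun c => (c != phi v) ==> [exists u, e v u && (phi u == c)])
      (enum_fset (L v)).

Definition frozen_col (phi : {ffun T -> nat}) : bool :=
  Lcol phi && [forall v, frozen_vertex phi v].

Definition unfrozen_col (phi : {ffun T -> nat}) : bool :=
  Lcol phi && [exists v, ~~ frozen_vertex phi v].

Definition unfrozen_walk_within (d : nat) (phi psi : {ffun T -> nat}) : Prop :=
  exists s : seq {ffun T -> nat},
    [/\ all unfrozen_col (phi :: s), path recol_step phi s,
        last phi s = psi & size s <= d].

(* every L-colour is smaller than colour_bound, so L-colourings are
   exactly (the images of) functions T -> 'I_colour_bound that are
   L-colourings *)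
Definition colour_bound : nat := \max_(v : T) \max_(c <- enum_fset (L v)) c.+1.

Definition as_col (f : {ffun T -> 'I_colour_bound}) : {ffun T -> nat} :=
  [ffun v => nat_of_ord (f v)].

Definition num_frozen : nat :=
  #|[set f : {ffun T -> 'I_colour_bound} | frozen_col (as_col f)]|.

Definition num_unfrozen : nat :=
  #|[set f : {ffun T -> 'I_colour_bound} | unfrozen_col (as_col f)]|.

Definition good_pair : Prop :=
  [/\ simple_graph, connected_graph, 3 <= maxdeg &
      forall v, deg v < #|` L v|%fset].

End Recolouring.

(* Main.v *)
(* Connectivity.  At a frozen vertex v the colours on N[v] are distinct and exhaust
   L(v), so recolouring a vertex frees its old colour for each frozen neighbour: an
   unfrozen "token" can be moved along any path.  Fix w of degree at least 3, change
   the target psi so that w is unfrozen, and peel off the vertices v by decreasing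
   distance from w, each time bringing v to its final colour psi(v) at linear cost
   while some other remaining vertex stays unfrozen.  If v alone is left unfrozen,
   its free colour is passed along a geodesic to an edge xy and back, with the effect
   of swapping the colours of x and y; this unfreezes every vertex adjacent to
   exactly one of them.  When no such swap exists, the rest of the graph is a clique,
   which is frozen under psi as well, or has no vertex of degree 3.

   Counting.  Swapping the colours of adjacent x and y with N[x] <> N[y] turns a
   frozen colouring into one whose unfrozen vertices are all within distance 1
   of x or y.  Every
   vertex lies on such an edge, and the swapped colouring determines the edge up to
   O(Delta^2) choices, so #frozen * n <= #unfrozen * O(Delta^2). *)

Require Import Defs.
From HB Require Import structures.
From mathcomp Require Import all_boot all_order all_algebra.
From mathcomp Require Import finmap.
From mathcomp Require Import zify ring.
From Stdlib Require Import Classical.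
Set Implicit Arguments. Unset Strict Implicit. Unset Printing Implicit Defensive.
Import Order.TTheory GRing.Theory Num.Theory.

(** * Available colours and the neighbourhood of a frozen vertex *)

Section Moves.
Variables (T : finType) (e : rel T) (L : T -> {fset nat}).
Hypotheses (sym_e : symmetric e) (irr_e : irreflexive e).
Hypothesis large_lists : forall v, deg e v < #|` L v|%fset.
Implicit Types (phi psi : {ffun T -> nat}) (S F : {set T}) (u v w x y z : T).

Notation Lc := (Lcol e L).
Notation frozen := (frozen_vertex e L).

Definition upd phi y c : {ffun T -> nat} := [ffun z => if z == y then c else phi z].

(** In an L-colouring the present colour of [y] counts as available, so moving to an available
    colour may change nothing. *)
Definition avail phi y c := (c \in L y) && [forall z, e y z ==> (phi z != c)].

Lemma availP phi y c :
  reflect (c \in L y /\ forall z, e y z -> phi z != c) (avail phi y c).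
Proof.
apply: (iffP andP) => [] [-> h]; split=> //.
  by move=> z ez; move/forallP/(_ z)/implyP: h; apply.
by apply/forallP => z; apply/implyP; apply: h.
Qed.

Lemma LcolP phi :
  reflect ((forall u v, e u v -> phi u != phi v) /\ forall v, phi v \in L v) (Lc phi).
Proof.
apply: (iffP andP) => [] [h1 h2]; split.
- by move=> u v; move/forallP/(_ u)/forallP/(_ v)/implyP: h1.
- by move=> v; move/forallP/(_ v): h2.
- by apply/forallP => u; apply/forallP => v; apply/implyP/h1.
- by apply/forallP.
Qed.

Lemma unfrozenP phi v :
  reflect (exists2 c, avail phi v c & c != phi v) (~~ frozen phi v).
Proof.
rewrite /frozen_vertex -has_predC; apply: (iffP hasP) => [[c cL]|[c /availP[cL h] cv]].
  rewrite /= negb_imply => /andP[cv /existsPn h]; exists c => //.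
  apply/availP; split=> // z ez; move: (h z); by rewrite ez.
exists c => //=; rewrite negb_imply cv; apply/existsPn => z.
by apply/negP => /andP[/h /negP].
Qed.

Lemma frozen_nbr phi v c : frozen phi v -> c \in L v -> c != phi v ->
  exists2 u, e v u & phi u = c.
Proof.
by move=> /allP fv cL cv; move: (fv _ cL); rewrite cv => /existsP[u /andP[? /eqP]]; exists u.
Qed.

(** Pigeonhole: [A] is too small to show all colours of [M] and still have a repetition or a colour
    outside [M]. *)
Lemma rainbow phi (A : {set T}) (M : seq nat) :
  uniq M -> #|A| <= size M -> (forall m, m \in M -> exists2 u, u \in A & phi u = m) ->
  {in A &, injective phi} /\ {in A, forall u, phi u \in M}.
Proof.
move=> uM sM cov; pose s := [seq phi u | u <- enum A].
have ss : {subset M <= s}.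
  by move=> m /cov[u uA <-]; apply: map_f; rewrite mem_enum.
have szs : size s <= size M by rewrite size_map -cardE.
have [_ eqs] := uniq_min_size uM ss szs.
have /dinjectiveP inj : dinjectiveb phi (mem A) := leq_size_uniq uM ss szs.
by split=> // u uA; rewrite eqs; apply: map_f; rewrite mem_enum.
Qed.

(** All [|L(v)| - 1 >= deg(v)] colours other than [phi v] occur on the neighbours of [v], so each
    occurs there exactly once. *)
Lemma frozen_rainbow phi v : frozen phi v -> phi v \in L v ->
  (forall u, e v u -> phi u \in L v) /\
  (forall u u', e v u -> e v u' -> phi u = phi u' -> u = u').
Proof.
move=> fv vL.
have [||m|inj im] := @rainbow phi [set u | e v u] (rem (phi v) (enum_fset (L v))).
- exact/rem_uniq/fset_uniq.
- by rewrite size_rem // -ltnS (ltn_predK (large_lists v)); apply: large_lists.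
- rewrite mem_rem_uniq ?fset_uniq // inE => /andP[mv mL].
  by have [u eu <-] := frozen_nbr fv mL mv; exists u; rewrite ?inE.
split=> [u eu|u u' eu eu']; last by apply: inj; rewrite inE.
have := im u; rewrite inE => /(_ eu); rewrite mem_rem_uniq ?fset_uniq // inE.
by case/andP.
Qed.


Lemma upd_id phi y : upd phi y (phi y) = phi.
Proof. by apply/ffunP => z; rewrite ffunE; case: eqP => [->|]. Qed.

Lemma upd_Lcol phi y c : Lc phi -> avail phi y c -> Lc (upd phi y c).
Proof.
move=> /LcolP[pr li] /availP[cL h]; apply/LcolP; split=> [u v euv|v]; rewrite !ffunE.
  case: (u =P y) => [uy|uy]; case: (v =P y) => [vy|vy]; subst.
  - by rewrite irr_e in euv.
  - by rewrite eq_sym h.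
  - by rewrite h // sym_e.
  - exact: pr.
by case: eqP => [->|].
Qed.

Lemma avail_self phi y : Lc phi -> avail phi y (phi y).
Proof. by case/LcolP => pr li; apply/availP; split=> // z /pr; rewrite eq_sym. Qed.

Lemma avail_undo phi y c : Lc phi -> avail (upd phi y c) y (phi y).
Proof.
move=> cphi; have /availP[yL h] := avail_self y cphi; apply/availP; split=> // z ez.
by rewrite ffunE; case: (z =P y) => [zy|_]; [rewrite zy irr_e in ez | exact: h].
Qed.

Lemma unfrozenI phi v c : avail phi v c -> c != phi v -> ~~ frozen phi v.
Proof. by move=> ? ?; apply/unfrozenP; exists c. Qed.

Lemma frozen_upd phi v y c : v != y -> ~~ e v y -> frozen (upd phi y c) v = frozen phi v.
Proof.
move=> vy evy; rewrite /frozen_vertex; apply: eq_in_all => m _.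
rewrite ffunE (negPf vy); congr (_ ==> _); apply: eq_existsb => u.
by rewrite ffunE; case: (u =P y) => // ->; rewrite (negPf evy).
Qed.

Lemma frozen_Lcol phi v : Lc phi -> frozen phi v ->
  (forall u, e v u -> phi u \in L v) /\
  (forall u u', e v u -> e v u' -> phi u = phi u' -> u = u').
Proof. by move=> /LcolP[_ li] fv; apply: frozen_rainbow. Qed.

(** Around a frozen [u] colours do not repeat, so [y] alone was blocking [phi y]. *)
Lemma frozen_freed phi u y c : Lc phi -> frozen phi u -> e u y -> c != phi y ->
  avail (upd phi y c) u (phi y).
Proof.
move=> cphi fu euy cy; have [im inj] := frozen_Lcol cphi fu.
apply/availP; split=> [|z ez]; first exact: im.
rewrite ffunE; case: (z =P y) => // zy; apply/eqP => /(inj _ _ ez euy); exact: zy.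
Qed.

Lemma frozen_freed_unfrozen phi u y c : Lc phi -> frozen phi u -> e u y ->
  c != phi y -> ~~ frozen (upd phi y c) u.
Proof.
move=> cphi fu euy cy; apply: (unfrozenI (frozen_freed cphi fu euy cy)).
have /LcolP[pr _] := cphi; rewrite ffunE; case: (u =P y) => [uy|_]; first by rewrite uy irr_e in euy.
by rewrite eq_sym pr.
Qed.

(** * Sequences of recolourings confined to a vertex set *)

(* A step may be void (c = phi y), hence k only bounds the number of recolourings. *)
Inductive reach S : nat -> {ffun T -> nat} -> {ffun T -> nat} -> Prop :=
| reach_refl k phi : reach S k phi phi
| reach_step k phi y c psi : y \in S -> avail phi y c ->
    reach S k (upd phi y c) psi -> reach S k.+1 phi psi.

Lemma reach_leq S k k' phi psi : k <= k' -> reach S k phi psi -> reach S k' phi psi.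
Proof.
move=> kk' r; elim: r k' kk' => [k1 phi1|k1 phi1 y c psi1 yS av _ IH] k' kk'.
  exact: reach_refl.
by case: k' kk' => // k' kk'; apply: reach_step av _ => //; apply: IH.
Qed.

Lemma reach_trans S k k' phi psi chi :
  reach S k phi psi -> reach S k' psi chi -> reach S (k + k') phi chi.
Proof.
elim=> [k1 phi1|k1 phi1 y c psi1 yS av _ IH] r'; first exact: reach_leq (leq_addl _ _) r'.
by rewrite addSn; apply: reach_step av _ => //; apply: IH.
Qed.

Lemma reach_one S phi y c : y \in S -> avail phi y c -> reach S 1 phi (upd phi y c).
Proof. by move=> yS av; apply: reach_step av _ => //; apply: reach_refl. Qed.

Lemma reach_Lcol S k phi psi : reach S k phi psi -> Lc phi -> Lc psi.
Proof. by elim=> // k1 phi1 y c psi1 yS av _ IH cphi; apply/IH/upd_Lcol. Qed.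

Lemma reach_off S k phi psi z : reach S k phi psi -> z \notin S -> psi z = phi z.
Proof.
move=> r zS; elim: r => // k1 phi1 y c psi1 yS _ _ ->; rewrite ffunE.
by case: eqP => // zy; rewrite zy yS in zS.
Qed.

Lemma reach_sub S S' k phi psi : S \subset S' -> reach S k phi psi -> reach S' k phi psi.
Proof.
move=> /subsetP SS'; elim=> [k1 phi1|k1 phi1 y c psi1 yS av _ IH]; first exact: reach_refl.
by apply: reach_step av IH; apply: SS'.
Qed.

Lemma reach_sym S k phi psi : Lc phi -> reach S k phi psi -> reach S k psi phi.
Proof.
move=> + r; elim: r => [k1 phi1 _|k1 phi1 y c psi1 yS av _ IH cphi]; first exact: reach_refl.
rewrite -addn1; apply: (reach_trans (IH (upd_Lcol cphi av))).
have {2}<- : upd (upd phi1 y c) y (phi1 y) = phi1.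
  by apply/ffunP => z; rewrite !ffunE; case: eqP => [->|].
exact: reach_one (avail_undo y c cphi).
Qed.

(** A vertex that has really changed colour can change back, so it is unfrozen after its step. *)
Lemma reach_unfrozen S k phi psi : Lc phi -> reach S k phi psi ->
  (exists2 y, y \in S & ~~ frozen phi y) -> exists2 y, y \in S & ~~ frozen psi y.
Proof.
move=> + r; elim: r => // k1 phi1 y c psi1 yS av _ IH cphi ex.
apply: (IH (upd_Lcol cphi av)).
have [cy|cy] := eqVneq c (phi1 y); first by rewrite cy upd_id.
exists y => //; apply: (unfrozenI (avail_undo y c cphi)).
by rewrite ffunE eqxx eq_sym.
Qed.

(** If the next vertex [u] of the path is frozen, recolouring [y] frees [phi y] for it; otherwise
    nothing is done. Hence at most one step per edge. *)
Lemma move_token S phi y p : Lc phi -> y \in S -> all (mem S) p -> path e y p ->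
  ~~ frozen phi y ->
  exists2 phi', reach S (size p) phi phi' & ~~ frozen phi' (last y p).
Proof.
elim: p phi y => [|u p IH] phi y cphi yS /=; first by exists phi => //; apply: reach_refl.
move=> /andP[uS pS] /andP[eyu pp] /unfrozenP[c av cy].
have [fu|fu] := boolP (frozen phi u); last first.
  by have [phi' r f'] := IH _ _ cphi uS pS pp fu; exists phi' => //; apply: reach_leq r.
have euy : e u y by rewrite sym_e.
have [phi' r f'] :=
  IH _ _ (upd_Lcol cphi av) uS pS pp (frozen_freed_unfrozen cphi fu euy cy).
by exists phi' => //; apply: reach_step av r.
Qed.

(** * Bringing one vertex to a prescribed colour *)

Lemma recolour_avail S phi v c : v \in S -> avail phi v c ->
  exists2 phi', reach S 1 phi phi' & phi' v = c.
Proof.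
move=> vS av; exists (upd phi v c); first exact: reach_one.
by rewrite ffunE eqxx.
Qed.

Lemma recolour_nbr_first S phi v u c d : v \in S -> u \in S -> c \in L v ->
  (forall u', e v u' -> phi u' = c -> u' = u) -> avail phi u d -> d != c ->
  exists2 phi', reach S 2 phi phi' & phi' v = c.
Proof.
move=> vS uS cL uniqc av dc.
have [|phi' r h] := @recolour_avail S (upd phi u d) v c vS.
  apply/availP; split=> // z ez; rewrite ffunE; case: (z =P u) => // zu.
  by apply/eqP => /(uniqc _ ez).
by exists phi' => //; apply: reach_step av r.
Qed.

Lemma recolour_unique_nbr S phi v u c : Lc phi -> v \in S -> u \in S -> c \in L v ->
  (forall u', e v u' -> phi u' = c -> u' = u) -> ~~ frozen phi v ->
  exists2 phi', reach S 3 phi phi' & phi' v = c.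
Proof.
move=> cphi vS uS cL uniqc /unfrozenP[a' av a'v].
have [vc|vc] := eqVneq (phi v) c; first by exists phi => //; apply: reach_refl.
have [/andP[euv /eqP uc]|nuc] := boolP (e v u && (phi u == c)); last first.
  have [|phi' r h] := @recolour_avail S phi v c vS.
    apply/availP; split=> // z ez; apply/eqP => zc; move: nuc.
    by rewrite -(uniqc _ ez zc) ez zc eqxx.
  by exists phi' => //; apply: reach_leq r.
have [fu|/unfrozenP[d ad du]] := boolP (frozen phi u); last first.
  have [|phi' r h] := recolour_nbr_first vS uS cL uniqc ad; first by rewrite -uc.
  by exists phi' => //; apply: reach_leq r.
(* When [u] is frozen, [v] first steps aside to [a']; [u] then takes the old colour of [v], and [v]
   takes [c]. *)
have [phi' r h] : exists2 phi', reach S 2 (upd phi v a') phi' & phi' v = c.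
  apply: (@recolour_nbr_first S _ v u c (phi v)) => //.
    move=> u' eu'; rewrite ffunE; case: (u' =P v) => [u'v|_]; last exact: uniqc.
    by rewrite u'v irr_e in eu'.
  by apply: frozen_freed => //; rewrite sym_e.
by exists phi' => //; apply: reach_step av r.
Qed.


(* For nested updates: a neighbour is either an updated vertex or covered by a
   hypothesis saying that the colour occurs only once around the vertex. *)
Ltac avail_tac :=
  apply/availP; split; [done | let z := fresh "z" in let ez := fresh "ez" in
  move=> z ez; rewrite !ffunE;
  repeat match goal with |- context [if z == ?b then _ else _] =>
    case: (z =P b) => [?|?]; [subst z|] end;
  first [ done | by rewrite eq_sym | by rewrite irr_e in ez
        | match goal with H : is_true (e ?a ?b), H' : is_true (~~ e ?a ?b) |- _ =>
            by rewrite H in H' end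
        | match goal with H : is_true (e ?a ?b), H' : is_true (~~ e ?b ?a) |- _ =>
            by rewrite sym_e H in H' end
        | match goal with U : forall w, is_true (e ?y w) -> _ -> _ , E : is_true (e ?y z)
            |- is_true (_ z != _) => by apply/eqP => /(U z E) end
        | idtac ] ].

Lemma small_leq k m n : k <= n -> k <= m + n.
Proof. by move=> kn; apply: leq_trans kn (leq_addl _ _). Qed.

(* The token walks to u1.  It gets stuck only at a neighbour r0 of v whose single
   free colour is c; then c is given to r0 and v takes the old colour of r0 or r1,
   which allows both r0 and u1 to leave c. *)
Lemma recolour_frozen S phi v c r0 u1 p : Lc phi -> v \in S -> c \in L v ->
  all (mem (S :\ v)) (r0 :: p) -> path e r0 p -> last r0 p = u1 -> e v u1 ->
  phi u1 = c -> frozen phi v -> ~~ frozen phi r0 ->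
  exists2 phi', reach S (size p + 7) phi phi' & phi' v = c.
Proof.
move=> + vS cLv; elim: p phi r0 => [|r1 p IH] phi r0 cphi.
  move=> /andP[/setD1P[r0v r0S] _] _ /= <- evr0 r0c fv /unfrozenP[d ad dr0].
  have [vim vinj] := frozen_Lcol cphi fv.
  have [||phi' r h] := @recolour_nbr_first S phi v r0 c d vS r0S cLv _ ad _.
  - by move=> u' eu' u'c; apply: vinj => //; rewrite u'c.
  - by rewrite -r0c.
  by exists phi' => //; apply: reach_leq r; apply: small_leq.
rewrite [path _ _ _]/= [last _ _]/=.
move=> /andP[/setD1P[r0v r0S] pS] /andP[er pp] lp evu1 u1c fv unf0.
change (is_true (all (mem (S :\ v)) (r1 :: p))) in pS.
have u1S : u1 \in S :\ v by have := allP pS _ (mem_last r1 p); rewrite lp.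
have [u1v u1S'] : u1 != v /\ u1 \in S by case/setD1P: u1S.
have [vim vinj] := frozen_Lcol cphi fv.
have uniqc z : e v z -> phi z = c -> z = u1 by move=> ez zc; apply: vinj => //; rewrite zc.
have [pr li] := LcolP _ cphi.
have [fu1|/unfrozenP[d ad du1]] := boolP (frozen phi u1); last first.
  have [|phi' r h] := recolour_nbr_first vS u1S' cLv uniqc ad; first by rewrite -u1c.
  by exists phi' => //; apply: reach_leq r; apply: small_leq.
have [f1|unf1] := boolP (frozen phi r1); last first.
  have [phi' r h] := IH _ _ cphi pS pp lp evu1 u1c fv unf1.
  by exists phi' => //; apply: reach_leq r; apply: leqnSn.
have [r1v r1S] : r1 != v /\ r1 \in S by move: pS => /= /andP[/setD1P[]].
have r0u1 : r0 != u1 by apply: contraNneq unf0 => ->.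
have er' : e r1 r0 by rewrite sym_e.
have r01 : r0 != r1 by apply: contraTneq er => ->; rewrite irr_e.
have [im1 inj1] := frozen_Lcol cphi f1.
have [imu injv] := frozen_Lcol cphi fu1.
(* If [r0] is not adjacent to [v], the token passes to [r1] without changing any colour around [v],
   which stays frozen. *)
have [evr0|evr0] := boolP (e v r0); last first.
  case/unfrozenP: unf0 => g ag gr0.
  have [|||phi' r h] := IH (upd phi r0 g) r1 (upd_Lcol cphi ag) pS pp lp evu1 _ _ _.
  - by rewrite ffunE eq_sym (negPf r0u1).
  - by rewrite frozen_upd // eq_sym.
  - exact: frozen_freed_unfrozen.
  by exists phi' => //; apply: reach_step ag r.
set a := phi v; set f := phi r0.
have fa : f != a by rewrite /f /a eq_sym pr.
have ca : c != a by rewrite -u1c /a eq_sym pr.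
have fc : f != c by apply/eqP => /(uniqc _ evr0) /eqP; rewrite (negPf r0u1).
have uniqf z : e v z -> phi z = f -> z = r0 by move=> ez zc; apply: vinj => //; rewrite zc.
have fLv : f \in L v by apply: vim.
have er0v : e r0 v by rewrite sym_e.
have eu1v : e u1 v by rewrite sym_e.
(* Now [r0] is adjacent to [v]. If it has a third colour [g], it can leave [f], which unfreezes [v],
   while [c] still sits on [u1] alone. *)
have [/hasP[g gL /= /and3P[ag gf gc]]|onlyc] :=
    boolP (has [pred g | [&& avail phi r0 g, g != f & g != c]] (enum_fset (L r0))).
  have [|||phi' r h] := @recolour_unique_nbr S (upd phi r0 g) v u1 c _ vS u1S' cLv.
  - exact: upd_Lcol.
  - move=> u' eu'; rewrite ffunE; case: (u' =P r0) => [_ /eqP|_]; last exact: uniqc.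
    by rewrite (negPf gc).
  - exact: frozen_freed_unfrozen.
  have {}r := reach_step r0S ag r.
  by exists phi' => //; apply: reach_leq r; apply: small_leq.
have others g : g \in L r0 -> g != f -> g != c -> ~~ avail phi r0 g.
  by move=> gL gf gc; move/hasPn: onlyc => /(_ _ gL) /=; rewrite gf gc !andbT.
have ac : avail phi r0 c.
  case/unfrozenP: unf0 => g ag gr0; have [<- //|gc] := eqVneq g c.
  by have gL := (proj1 (availP _ _ _ ag)); have := others _ gL gr0 gc; rewrite ag.
have cL0 : c \in L r0 by case/availP: ac.
have nc0 z : e r0 z -> phi z != c by case/availP: ac => _; apply.
have n01 : ~~ e r0 u1 by apply/negP => /nc0; rewrite u1c eqxx.
have n10 : ~~ e u1 r0 by rewrite sym_e.
have aLu : a \in L u1 by apply: imu.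
have uniqau z : e u1 z -> phi z = a -> z = v by move=> ez za; apply: injv.
have done1 psi k : reach S k phi psi -> avail psi v c -> k <= 6 ->
  exists2 phi', reach S ((size p).+1 + 7) phi phi' & phi' v = c.
  move=> r av kp; have [phi' r' h] := recolour_avail vS av.
  by exists phi' => //; apply: reach_leq (reach_trans r r'); apply: small_leq; rewrite addn1.
(* First case: v is the only obstacle to giving r0 its colour a.  Otherwise the
   neighbours of r0 other than v exhaust L r0 except for f and c. *)
have [/andP[aL0 /forallP na0]|beta] :=
    boolP ((a \in L r0) && [forall z, e r0 z && (z != v) ==> (phi z != a)]).
  have uniqa0 z : e r0 z -> phi z = a -> z = v.
    by move=> ez za; apply/eqP; move: (na0 z); rewrite ez za eqxx /=; case: eqP.
  apply: (done1 (upd (upd (upd (upd phi r0 c) v f) u1 a) r0 a) 4) => //.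
    apply: (reach_step r0S ac); apply: (@reach_step _ _ _ v f) => //; first by avail_tac.
    apply: (@reach_step _ _ _ u1 a) => //; first by avail_tac.
    apply: reach_one => //; by avail_tac.
  by avail_tac.
have fL0 : f \in L r0 := li r0.
(* Every colour of [L r0] other than [f] and [c] is blocked by a neighbour of [r0], and [a], if
   listed, by one other than [v]. So the neighbours other than [v] show each of these colours
   exactly once. *)
have [inj0 im0] : {in [set u | e r0 u] :\ v &, injective phi} /\
    {in [set u | e r0 u] :\ v, forall u, phi u \in rem f (rem c (enum_fset (L r0)))}.
  apply: rainbow; first exact/rem_uniq/rem_uniq/fset_uniq.
    rewrite !size_rem //; last by rewrite mem_rem_uniq ?fset_uniq // inE fc.
    have := cardsD1 v [set u | e r0 u]; rewrite inE er0v => E.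
    by have := large_lists r0; rewrite /deg E; case: (size _) => // -[].
  move=> m; rewrite mem_rem_uniq ?rem_uniq ?fset_uniq // inE => /andP[mf].
  rewrite mem_rem_uniq ?fset_uniq // inE => /andP[mc mL].
  have := others _ mL mf mc; rewrite /avail mL /= => /forallPn[z].
  rewrite negb_imply negbK => /andP[ez /eqP zm].
  have [zv|zv] := eqVneq z v; last by exists z; rewrite ?inE ?zv.
  have am : a = m by rewrite -zm zv.
  move: beta; rewrite am mL /= => /forallPn[t].
  rewrite negb_imply negbK => /andP[/andP[et tv] /eqP ta].
  by exists t; rewrite ?inE ?tv.
set g := phi r1.
have r1A : r1 \in [set u | e r0 u] :\ v by rewrite !inE r1v.
have := im0 _ r1A; rewrite mem_rem_uniq ?rem_uniq ?fset_uniq // inE => /andP[gf].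
rewrite mem_rem_uniq ?fset_uniq // inE -/g in gf * => /andP[gc gL].
have gL0 : g \in L r0 by [].
have uniqg0 z : z <> v -> e r0 z -> phi z = g -> z = r1.
  by move=> /eqP zv ez zg; apply: inj0; rewrite // !inE zv.
have fL1 : f \in L r1 by apply: im1.
have uniqf1 z : e r1 z -> phi z = f -> z = r0 by move=> ez zf; apply: inj1.
have r1u1 : r1 != u1 by apply: contraNneq gc => E; rewrite /g E u1c.
have u1r1 : u1 != r1 by rewrite eq_sym.
have u1r0 : u1 != r0 by rewrite eq_sym.
have vr0 : v != r0 by rewrite eq_sym.
have vr1 : v != r1 by rewrite eq_sym.
have vu1 : v != u1 by rewrite eq_sym.
have r10 : r1 != r0 by rewrite eq_sym.
have [evr1|evr1] := boolP (e v r1).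
  have ga : g != a by rewrite /g /a eq_sym pr.
  have er1v : e r1 v by rewrite sym_e.
  have uniqg z : e r0 z -> phi z = g -> z = r1.
    by move=> ez zg; apply: uniqg0 => // zv; move/eqP: ga; rewrite -zg zv.
  have gLv : g \in L v by apply: vim.
  have uniqgv z : e v z -> phi z = g -> z = r1 by move=> ez zg; apply: vinj.
  (* If [r1] is adjacent to [u1], then [r1] vacates [g], which both [u1] and [r0] take. Otherwise
     [v] holds [g] for a while, so that [u1] and [r1] can share [a] and [r0] can return to [f]. *)
  have [e1u|e1u] := boolP (e r1 u1).
    have eu1 : e u1 r1 by rewrite sym_e.
    have gLu : g \in L u1 by apply: imu.
    have uniqgu z : e u1 z -> phi z = g -> z = r1 by move=> ez zg; apply: injv.
    apply: (done1 (upd (upd (upd (upd phi r0 c) r1 f) u1 g) r0 g) 4) => //.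
      apply: (reach_step r0S ac); apply: (@reach_step _ _ _ r1 f) => //; first by avail_tac.
      apply: (@reach_step _ _ _ u1 g) => //; first by avail_tac.
      apply: reach_one => //; by avail_tac.
    by avail_tac.
  have aL1 : a \in L r1 by apply: im1.
  have uniqa1 z : e r1 z -> phi z = a -> z = v by move=> ez za; apply: inj1.
  have nf0 z : e r0 z -> phi z != f by move=> ez; rewrite /f eq_sym pr.
  apply: (done1 (upd (upd (upd (upd (upd (upd phi r0 c) r1 f) v g) u1 a) r1 a) r0 f) 6) => //.
    apply: (reach_step r0S ac); apply: (@reach_step _ _ _ r1 f) => //; first by avail_tac.
    apply: (@reach_step _ _ _ v g) => //; first by avail_tac.
    apply: (@reach_step _ _ _ u1 a) => //; first by avail_tac.
    apply: (@reach_step _ _ _ r1 a) => //; first by avail_tac.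
    apply: reach_one => //; avail_tac; exact: nf0.
  by avail_tac.
have [ga|ga] := eqVneq g a.
  have uniqa0 z : z <> v -> e r0 z -> phi z = a -> z = r1 by rewrite -ga; exact: uniqg0.
  have aL0 : a \in L r0 by rewrite -ga.
  apply: (done1 (upd (upd (upd (upd (upd phi r0 c) r1 f) v f) u1 a) r0 a) 5) => //.
    apply: (reach_step r0S ac); apply: (@reach_step _ _ _ r1 f) => //; first by avail_tac.
    apply: (@reach_step _ _ _ v f) => //; first by avail_tac.
    apply: (@reach_step _ _ _ u1 a) => //; first by avail_tac.
    apply: reach_one => //; avail_tac; apply/eqP => za.
    by have zv : z <> v by []; have := uniqa0 z zv ez za.
  by avail_tac.
have uniqg z : e r0 z -> phi z = g -> z = r1.
  by move=> ez zg; apply: uniqg0 => // zv; move/eqP: ga; rewrite -zg zv.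
(* Here [r1] is not adjacent to [v]: once [r1] has [f] and [r0] has [g], the colour [f] is free at
   [v], and [c] sits on [u1] alone. *)
have a1 : avail (upd phi r0 c) r1 f by avail_tac.
have a2 : avail (upd (upd phi r0 c) r1 f) r0 g by avail_tac.
have c1 := upd_Lcol cphi ac; have c2 := upd_Lcol c1 a1; have c3 := upd_Lcol c2 a2.
have [||phi' r h] := recolour_unique_nbr c3 vS u1S' cLv.
- move=> u' eu'; rewrite !ffunE; case: (u' =P r0) => [_ /eqP|_]; first by rewrite (negPf gc).
  case: (u' =P r1) => [u'r|_]; last exact: uniqc.
  by rewrite u'r (negPf evr1) in eu'.
- apply: (@unfrozenI _ _ f); last by rewrite !ffunE (negPf vr0) (negPf vr1).
  by avail_tac.
have r2 := reach_step r0S ac (reach_step r1S a1 (reach_step r0S a2 r)).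
exists phi' => //; apply: reach_leq r2.
exact: small_leq.
Qed.

Definition inside S : rel T := [rel x y | [&& e x y, x \in S & y \in S]].

Definition connected_in S : Prop := {in S &, forall x y, connect (inside S) x y}.

Lemma connected_in_path S x y : connected_in S -> x \in S -> y \in S ->
  exists p, [/\ path e x p, all (mem S) p, last x p = y & size p < #|T|].
Proof.
move=> cS xS yS; have /connectP[q pq ->] := cS _ _ xS yS.
have [p pp up _] := shortenP pq; exists p; split=> //.
- by apply: sub_path pp => a b /and3P[].
- by elim: p x {xS pq up} pp => //= b p IH x /andP[/and3P[_ _ ->] /IH].
- by have := uniq_leq_size up (fun z _ => mem_enum T z); rewrite -cardE.
Qed.

(** Makes one neighbour of [v] leave [c] without another one taking it, and leaves a token there in
    case [v] gets frozen. If [u] is frozen, [v] moves first and [u] inherits its old colour. *)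
Lemma reduce_colour_nbrs S phi v u c : Lc phi -> v \in S -> u \in S -> e v u ->
  phi u = c -> ~~ frozen phi v ->
  exists2 psi, reach S 2 phi psi & [/\ ~~ frozen psi u, psi u != c &
    forall z, e v z -> psi z = c -> phi z = c].
Proof.
move=> cphi vS uS evu uc /unfrozenP[a' av a'v].
have euv : e u v by rewrite sym_e.
have [fu|/unfrozenP[d ad du]] := boolP (frozen phi u); last first.
  exists (upd phi u d); first by apply: reach_leq (reach_one uS ad).
  split.
  - by apply: (unfrozenI (avail_undo u d cphi)); rewrite ffunE eqxx eq_sym.
  - by rewrite ffunE eqxx -uc.
  - by move=> z _; rewrite ffunE; case: (z =P u) => [->|].
have c1 := upd_Lcol cphi av.
have av2 := frozen_freed cphi fu euv a'v.
have [pr _] := LcolP _ cphi.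
have uv : (u == v) = false by apply: contraTF evu => /eqP->; rewrite irr_e.
have vc : phi v != c by rewrite -uc pr.
exists (upd (upd phi v a') u (phi v)).
  by apply: reach_step vS av _; apply: reach_one.
split.
- by apply: (unfrozenI (avail_undo u (phi v) c1)); rewrite !ffunE eqxx uv uc eq_sym.
- by rewrite !ffunE eqxx.
- move=> z ez; rewrite !ffunE; case: (z =P u) => [->|_]; first by rewrite uc.
  by case: (z =P v) => // zv; rewrite zv irr_e in ez.
Qed.

(** Each round removes [c] from one neighbour in two steps. If [v] gets frozen on the way, at most
    one neighbour still has [c], and the token left on [u] lets [recolour_frozen] finish. *)
Lemma recolour_unfrozen S phi v c k : Lc phi -> connected_in (S :\ v) -> v \in S ->
  c \in L v -> (forall u, e v u -> phi u = c -> u \in S) -> ~~ frozen phi v ->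
  #|[set u | e v u & phi u == c]| <= k ->
  exists2 phi', reach S (k.*2 + (#|T| + 8)) phi phi' & phi' v = c.
Proof.
move=> + con vS cL; elim: k phi => [|k IH] phi cphi inS fv; last first.
  have [/existsP[u /andP[euv /eqP uc]]|/existsPn none] :=
      boolP [exists u, e v u && (phi u == c)]; last first.
    move=> _; have [|phi' r h] := @recolour_avail S phi v c vS.
      by apply/availP; split=> // z ez; have := none z; rewrite ez.
    by exists phi' => //; apply: reach_leq r; apply/small_leq/small_leq.
  have uS := inS _ euv uc.
  have [psi r [fu puc sub]] := reduce_colour_nbrs cphi vS uS euv uc fv.
  have cpsi := reach_Lcol r cphi.
  rewrite (cardD1 u) inE euv uc eqxx ltnS => lek.
  have inS' z : e v z -> psi z = c -> z \in S by move=> ez /(sub _ ez); apply: inS.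
  have [fpv|fpv] := boolP (frozen psi v); last first.
    have [|phi' r' h] := IH psi cpsi inS' fpv.
      apply: leq_trans lek; apply/subset_leq_card/subsetP => z; rewrite !inE.
      move=> /andP[ez /eqP zc]; rewrite ez (sub _ ez zc) eqxx !andbT.
      by apply: contraNneq puc => <-; rewrite zc.
    by exists phi' => //; apply: reach_leq (reach_trans r r'); rewrite doubleS.
  have [/existsP[u1 /andP[eu1 /eqP u1c]]|/existsPn none] :=
      boolP [exists u, e v u && (psi u == c)]; last first.
    have [|phi' r' h] := @recolour_avail S psi v c vS.
      by apply/availP; split=> // z ez; have := none z; rewrite ez.
    by exists phi' => //; apply: reach_leq (reach_trans r r'); apply/small_leq/small_leq.
  have nv z : e v z -> z != v by apply: contraTneq => ->; rewrite irr_e.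
  have uSv : u \in S :\ v by rewrite !inE nv.
  have u1Sv : u1 \in S :\ v by rewrite !inE nv ?inS'.
  have [p [pp pS lp sp]] := connected_in_path con uSv u1Sv.
  have [|phi' r' h] := recolour_frozen cpsi vS cL _ pp lp eu1 u1c fpv fu.
    by rewrite /= uSv.
  exists phi' => //; apply: reach_leq (reach_trans r r').
  rewrite doubleS addSn addSn ltnS ltnS add0n; apply: small_leq.
  by apply: leq_add => //; apply: ltnW.
rewrite leqn0 cards_eq0 => /eqP none; have [|phi' r h] := @recolour_avail S phi v c vS.
  apply/availP; split=> // z ez; apply/negP => zc.
  by have := in_set0 z; rewrite -none inE ez zc.
by exists phi' => //; apply: reach_leq r; apply/small_leq/small_leq.
Qed.

(** * Swapping the colours of two adjacent vertices *)

Definition swap (R : Type) (f : {ffun T -> R}) x y : {ffun T -> R} :=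
  [ffun z => if z == x then f y else if z == y then f x else f z].

Lemma swapC (R : Type) (f : {ffun T -> R}) x y : swap f x y = swap f y x.
Proof.
by apply/ffunP => z; rewrite !ffunE; case: (z =P x) => [->|_]; case: eqP => // ->.
Qed.

(** Among the neighbours of [z] only [x] had the colour [phi x], which moves to the non-neighbour
    [y]. *)
Lemma swap_unfrozen phi x y z : Lc phi -> frozen phi z -> e x y -> z != x -> z != y ->
  e z x -> ~~ e z y -> ~~ frozen (swap phi x y) z.
Proof.
move=> cphi fz exy zx zy ezx ezy; have [pr _] := LcolP _ cphi.
have [im inj] := frozen_Lcol cphi fz; have xL := im _ ezx.
have yx : phi y != phi x by rewrite eq_sym pr.
have U t : e z t -> phi t = phi x -> t = x by move=> et; apply: inj.
apply: (@unfrozenI _ _ (phi x)); first by rewrite /swap; avail_tac.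
by rewrite !ffunE (negPf zx) (negPf zy) eq_sym pr.
Qed.

(** The moves are [v] to [b], [x] to [phi v], [y] to [phi x], [x] to [phi y], and [v] back. The
    condition [phi y != b] serves the fourth move, made while [v] holds [b]. *)
Lemma swap_adjacent S phi v b x y : Lc phi -> v \in S -> x \in S -> y \in S ->
  avail phi v b -> b != phi v -> e v x -> e x y -> y != v -> frozen phi x ->
  frozen phi y -> phi y != b -> reach S 5 phi (swap phi x y).
Proof.
move=> cphi vS xS yS av bv evx exy yv fx fy yb; have [pr li] := LcolP _ cphi.
have [imx injx] := frozen_Lcol cphi fx; have [imy injy] := frozen_Lcol cphi fy.
have exv : e x v by rewrite sym_e.
have eyx : e y x by rewrite sym_e.
have xb : phi x != b by case/availP: av => _; apply.
have xv : x != v by apply: contraTneq evx => ->; rewrite irr_e.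
have yx : y != x by apply: contraTneq exy => ->; rewrite irr_e.
have vL := imx _ exv; have xL := imy _ eyx; have yL := imx _ exy; have vLv := li v.
have Uv z : e x z -> phi z = phi v -> z = v by move=> ez; apply: injx.
have Ux z : e y z -> phi z = phi x -> z = x by move=> ez; apply: injy.
have Uy z : e x z -> phi z = phi y -> z = y by move=> ez; apply: injx.
have vx : phi v != phi x := pr _ _ evx.
have xy : phi x != phi y := pr _ _ exy.
have yv' : phi y != phi v by apply: contraNneq yv => /(Uv _ exy) ->.
have nv z : e v z -> phi z != phi v by move=> ez; rewrite eq_sym pr.
have -> : swap phi x y =
    upd (upd (upd (upd (upd phi v b) x (phi v)) y (phi x)) x (phi y)) v (phi v).
  apply/ffunP => z; rewrite !ffunE; case: (z =P v) => [->|_].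
    by rewrite eq_sym (negPf xv) eq_sym (negPf yv).
  by case: (z =P x).
apply: (reach_step vS av); apply: (@reach_step _ _ _ x (phi v)) => //; first by avail_tac.
apply: (@reach_step _ _ _ y (phi x)) => //; first by avail_tac.
apply: (@reach_step _ _ _ x (phi y)) => //; first by avail_tac.
apply: reach_one => //; avail_tac; exact: nv.
Qed.

(** As [x] and [y] are not adjacent to [v], the swap keeps the colours around [v], which can
    therefore return to its own. *)
Lemma swap_conj S phi v b x y k : Lc phi -> v \in S -> avail phi v b ->
  x != v -> y != v -> ~~ e v x -> ~~ e v y ->
  reach S k (upd phi v b) (swap (upd phi v b) x y) ->
  reach S k.+2 phi (swap phi x y).
Proof.
move=> cphi vS av xv yv evx evy r; have [pr li] := LcolP _ cphi.
apply: (reach_step vS av); rewrite -addn1; apply: reach_trans r _.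
have -> : swap phi x y = upd (swap (upd phi v b) x y) v (phi v).
  apply/ffunP => z; rewrite !ffunE (negPf xv) (negPf yv); case: (z =P v) => // ->.
  by rewrite eq_sym (negPf xv) eq_sym (negPf yv).
have vL := li v; apply: reach_one => //; rewrite /swap; avail_tac.
by rewrite eq_sym pr.
Qed.

(* The free colour of v is handed down the geodesic v :: q ++ [:: s; x], and handed
   back after the swap. *)
Lemma swap_along S (d : T -> nat) q phi v b s x y :
  {in S &, forall t z, e t z -> d z <= (d t).+1} ->
  Lc phi -> all (mem S) (y :: v :: q ++ [:: s; x]) ->
  all (frozen phi) (y :: q ++ [:: s; x]) ->
  path [rel t z | e t z && (d z == (d t).+1)] v (q ++ [:: s; x]) ->
  avail phi v b -> b != phi v -> e x y -> all (fun t => ~~ e t y) (v :: q) ->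
  phi y != phi (last v q) -> reach S ((size q).*2 + 7) phi (swap phi x y).
Proof.
move=> dS; elim: q phi v b => [|h q IH] phi v b cphi; rewrite [_ ++ _]/=.
  move=> /and5P[yS vS sS xS _] /and4P[fy fs fx _].
  rewrite /= => /and3P[/andP[evs /eqP ds] /andP[esx /eqP dx] _] av bv exy.
  rewrite andbT => evy yv; have [pr li] := LcolP _ cphi.
  have far t : d v < d t -> t != v by apply: contraTneq => ->; rewrite ltnn.
  have xv : x != v by apply: far; rewrite dx ds leqnSn.
  have evx : ~~ e v x by apply/negP => /(dS _ _ vS xS); rewrite dx ds ltnn.
  have evy' : ~~ e y v by rewrite sym_e.
  have yv' : y != v by apply: contraNneq evx => <-; rewrite sym_e.
  have sv : s != v by apply: far; rewrite ds.
  have esv : e s v by rewrite sym_e.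
  have ys : y != s by apply: contraNneq evy => ->.
  apply: (swap_conj cphi vS av) => //; apply: (@swap_adjacent _ _ s (phi v)) => //.
  - exact: upd_Lcol.
  - exact: frozen_freed.
  - by rewrite ffunE (negPf sv) pr.
  - by rewrite frozen_upd // sym_e.
  - by rewrite frozen_upd.
  - by rewrite ffunE (negPf yv').
move=> /and4P[yS vS hS aS] /and3P[fy fh af].
rewrite [path _ _ _]/= => /andP[/andP[evh /eqP dh] pq] av bv exy.
move=> /andP[evy ay] yl; have [pr li] := LcolP _ cphi.
have far t : t \in q ++ [:: s; x] -> (t \in S) && (d h < d t).
  move=> tq; have /= -> := allP aS _ tq; rewrite andTb.
  have d_tr : transitive [rel t z | d t < d z] by move=> t1 t2 t3; apply: ltn_trans.
  apply: (allP (order_path_min d_tr (_ : path _ h (q ++ [:: s; x])))) => //.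
  by apply: sub_path pq => t1 t2 /= /andP[_ /eqP->].
(* Beyond [h] the geodesic is at distance at least two from [v], so recolouring [v] leaves its
   vertices frozen. *)
have farv t : t \in q ++ [:: s; x] -> t != v /\ ~~ e t v.
  move=> /far/andP[tS dt]; split; first by apply: contraTneq dt => ->; rewrite dh -leqNgt.
  by apply/negP; rewrite sym_e => /(dS _ _ vS tS); rewrite -dh leqNgt dt.
have ev' : e h v by rewrite sym_e.
have hv : h != v by apply: contraTneq evh => ->; rewrite irr_e.
have [xv exv] : x != v /\ ~~ e x v by apply: farv; rewrite mem_cat !inE eqxx !orbT.
have yv : y != v by apply: contraNneq exv => <-.
have eyv : ~~ e y v by rewrite sym_e.
rewrite [size _]/= doubleS !addSn.
apply: (swap_conj cphi vS av) => //; first by rewrite sym_e.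
apply: (IH _ h (phi v)) => //.
- exact: upd_Lcol.
- by apply/andP; split=> //; apply/andP.
- apply/andP; split; first by rewrite frozen_upd.
  apply/allP => t tq; have [tv etv] := farv _ tq.
  by rewrite frozen_upd // (allP af).
- exact: frozen_freed.
- by rewrite ffunE (negPf hv) pr.
- rewrite !ffunE (negPf yv); case: (last h q =P v) => // lv.
  have := mem_last h q; rewrite lv inE eq_sym (negPf hv) /= => vq.
  by have [] := farv v; rewrite ?eqxx // mem_cat vq.
Qed.

(* Needed when phi x = b: v first steps aside to a third colour m, so that u can
   receive b. *)
Lemma swap_detour S phi v b u x m : Lc phi -> v \in S -> u \in S -> x \in S ->
  avail phi v b -> b != phi v -> e v u -> e u x -> x != v -> ~~ e v x ->
  phi x = b -> frozen phi u -> frozen phi x -> m != b ->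
  avail (upd (upd (upd phi v b) u (phi v)) x (phi u)) v m ->
  reach S 6 phi (swap phi u x).
Proof.
move=> cphi vS uS xS av bv evu eux xv evx xb fu fx mb avm; have [pr li] := LcolP _ cphi.
have [imu inju] := frozen_Lcol cphi fu; have [imx injx] := frozen_Lcol cphi fx.
have euv : e u v by rewrite sym_e.
have exu : e x u by rewrite sym_e.
have uv : u != v by apply: contraTneq evu => ->; rewrite irr_e.
have xu : x != u by apply: contraTneq eux => ->; rewrite irr_e.
have vL := imu _ euv; have uL := imx _ exu; have xL := imu _ eux; have vLv := li v.
have bLu : b \in L u by rewrite -xb.
have Uv z : e u z -> phi z = phi v -> z = v by move=> ez; apply: inju.
have Uu z : e x z -> phi z = phi u -> z = u by move=> ez; apply: injx.
have Ux z : e u z -> phi z = b -> z = x by rewrite -xb => ez; apply: inju.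
have vu : phi v != phi u := pr _ _ evu.
have ub : phi u != b by rewrite -xb pr.
have nv z : e v z -> phi z != phi v by move=> ez; rewrite eq_sym pr.
have -> : swap phi u x =
    upd (upd (upd (upd (upd (upd phi v b) u (phi v)) x (phi u)) v m) u b) v (phi v).
  apply/ffunP => z; rewrite !ffunE; case: (z =P v) => [->|_].
    by rewrite eq_sym (negPf uv) eq_sym (negPf xv).
  by case: (z =P u) => // _; rewrite xb.
apply: (reach_step vS av); apply: (@reach_step _ _ _ u (phi v)) => //; first by avail_tac.
apply: (@reach_step _ _ _ x (phi u)) => //; first by avail_tac.
apply: (reach_step vS avm).
apply: (@reach_step _ _ _ u b) => //; first by avail_tac.
apply: reach_one => //; avail_tac; exact: nv.
Qed.

(** Each detour needs a third colour for [v]. If none is left after the first three moves through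
    [u], then [v] is frozen there and its neighbours have distinct colours; so [phi u'] originally
    sits on [u'] alone and becomes free for [v] in the other detour. *)
Lemma swap_detour2 S phi v b u x u' x' : Lc phi -> v \in S ->
  avail phi v b -> b != phi v -> phi u != phi u' ->
  [&& u \in S, x \in S, e v u, e u x & x != v] ->
  [/\ ~~ e v x, phi x = b, frozen phi u & frozen phi x] ->
  [&& u' \in S, x' \in S, e v u', e u' x' & x' != v] ->
  [/\ ~~ e v x', phi x' = b, frozen phi u' & frozen phi x'] ->
  reach S 6 phi (swap phi u x) \/ reach S 6 phi (swap phi u' x').
Proof.
move=> cphi vS av bv uu' /and5P[uS xS evu eux xv] [evx xb fu fx].
move=> /and5P[uS' xS' evu' eux' xv'] [evx' xb' fu' fx'].
set phi3 := upd (upd (upd phi v b) u (phi v)) x (phi u).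
have uv : u != v by apply: contraTneq evu => ->; rewrite irr_e.
have v3 : phi3 v = b.
  by rewrite !ffunE eq_sym (negPf xv) eq_sym (negPf uv) eqxx.
have [f3|/unfrozenP[m am mb]] := boolP (frozen phi3 v); last first.
  by left; apply: (swap_detour cphi vS uS xS av bv _ _ _ _ _ _ _ _ am); rewrite // -v3.
right; have [bL nb] := availP _ _ _ av.
have [im inj] : (forall z, e v z -> phi3 z \in L v) /\
    (forall z z', e v z -> e v z' -> phi3 z = phi3 z' -> z = z').
  by apply: frozen_rainbow; rewrite // v3.
have phi3E z : e v z -> z != u -> phi3 z = phi z.
  move=> ez zu; rewrite !ffunE (negPf zu); case: (z =P x) => [zx|_].
    by rewrite zx (negPf evx) in ez.
  by case: (z =P v) => // zv; rewrite zv irr_e in ez.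
have u'u : u' != u by apply: contraNneq uu' => ->.
have [pr _] := LcolP _ cphi; have vu' := pr _ _ evu'.
have aL : phi u' \in L v by rewrite -phi3E // im.
have ub' : b != phi u' by rewrite eq_sym nb.
apply: (swap_detour (m := phi u') cphi vS uS' xS' av bv) => //; first by rewrite eq_sym.
avail_tac; apply/eqP => zu'; have [zu|zu] := eqVneq z u.
  by move: uu'; rewrite -zu zu' eqxx.
have : z = u' by apply: inj; rewrite // !phi3E.
by [].
Qed.

(** * Distances inside a vertex set, and unlocking a set of frozen vertices *)

Lemma distance_in S v : v \in S -> connected_in S -> exists d : T -> nat,
  [/\ forall z, z \in S -> (d z == 0) = (z == v),
      forall z, z \in S -> z != v -> exists t, [/\ t \in S, e t z & d z = (d t).+1],
      {in S &, forall t z, e t z -> d z <= (d t).+1} &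
      forall z, z \in S -> d z < #|T| ].
Proof.
move=> vS cS.
(* Breadth-first search: [B n] is the ball of radius [n] around [v] inside [S], and for [z] in [S]
   the first ball containing [z] has index [d z]. *)
pose B n := iter n (fun A => A :|: [set z in S | [exists t in A, e t z]]) [set v].
pose d z := find (fun n => z \in B n) (iota 0 #|T|).
have BS n z : z \in B n.+1 = (z \in B n) || (z \in S) && [exists t in B n, e t z].
  by rewrite /B iterS !inE.
have BSub n z : z \in B n -> z \in S.
  by elim: n z => [|n IH] z; [rewrite inE => /eqP-> | rewrite BS => /orP[/IH|/andP[]]].
have Bpath p x n : x \in B n -> all (mem S) p -> path e x p -> last x p \in B (n + size p).
  elim: p x n => [|y p IH] x n xB /=; first by rewrite addn0.
  move=> /andP[yS pS] /andP[exy pp]; rewrite addnS -addSn; apply: IH => //.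
  by rewrite BS yS; apply/orP; right; apply/existsP; exists x; rewrite xB.
have dmin z n : z \in B n -> d z <= n.
  move=> zB; rewrite leqNgt; apply/negP => lt.
  have ltT : n < #|T|.
    by apply: leq_trans lt _; rewrite -[X in _ <= X](size_iota 0); apply: find_size.
  by have := before_find 0 lt; rewrite nth_iota // add0n zB.
have dP z : z \in S -> z \in B (d z) /\ d z < #|T|.
  move=> zS; have [p [pp pS <- sp]] := connected_in_path cS vS zS.
  have hs : has (fun n => last v p \in B n) (iota 0 #|T|).
    apply/hasP; exists (size p); first by rewrite mem_iota.
    by have := @Bpath p v 0 _ pS pp; rewrite inE eqxx; apply.
  have dT : d (last v p) < #|T| by rewrite -[X in _ < X](size_iota 0) -has_find.
  by have := nth_find 0 hs; rewrite nth_iota.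
have lip : {in S &, forall t z, e t z -> d z <= (d t).+1}.
  move=> t z tS zS etz; apply: dmin; rewrite BS zS; apply/orP; right.
  by apply/existsP; exists t; rewrite (proj1 (dP _ tS)).
have d0 z : z \in S -> (d z == 0) = (z == v).
  move=> zS; apply/eqP/eqP => [E|->]; first by have [] := dP _ zS; rewrite E inE => /eqP.
  by apply/eqP; rewrite -leqn0 dmin // inE.
exists d; split=> // [z zS zv|z /dP[]//].
have [zB _] := dP _ zS; case E: (d z) => [|n]; first by move/eqP: E; rewrite d0 // (negPf zv).
move: zB; rewrite E BS => /orP[/dmin|]; first by rewrite E ltnn.
case/andP=> _ /existsP[t /andP[tB etz]]; have tS := BSub _ _ tB.
exists t; split=> //; apply/eqP; rewrite eqSS eqn_leq dmin // andbT.
by rewrite -ltnS -E lip.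
Qed.

(** For the case that [v] is the only unfrozen vertex of [S]. If no swap inside [F] helps, the ends
    of every feasible swap are twins in [F]; this leaves each vertex of [F] at most two neighbours
    in [S], contrary to the choice of [w]. *)
Lemma unlock F v w phi : let S := v |: F in
  Lc phi -> v \notin F -> {in F, forall z, frozen phi z} -> ~~ frozen phi v ->
  connected_in S -> connected_in F ->
  (exists x y, [/\ x \in F, y \in F, x != y & ~~ e x y]) ->
  w \in F -> 3 <= #|[set z in S | e w z]| ->
  exists2 phi', reach S (#|T|.*2 + 7) phi phi' &
    phi' v = phi v /\ exists2 y, y \in F & ~~ frozen phi' y.
Proof.
move=> S cphi vF frF /unfrozenP[b av bv] cS cF nclique wF deg3; apply: NNPP => stuck.
have [pr li] := LcolP _ cphi; have [bL nb] := availP _ _ _ av.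
have vS : v \in S by rewrite !inE eqxx.
have FS z : z \in F -> z \in S by rewrite !inE => ->; rewrite orbT.
have SF z : z \in S -> z != v -> z \in F by rewrite !inE => /orP[->|].
have Fv z : z \in F -> z != v by apply: contraTneq => ->.
have irr z t : e z t -> z != t by apply: contraTneq => ->; rewrite irr_e.
have rb z t t' : z \in F -> e z t -> e z t' -> phi t = phi t' -> t = t'.
  by move=> zF; have [_ inj] := frozen_Lcol cphi (frF z zF); apply: inj.
have twinF x y k : x \in F -> y \in F -> e x y -> k <= #|T|.*2 + 7 ->
    reach S k phi (swap phi x y) -> {in F, forall z, z != x -> z != y -> e z x = e z y}.
  move=> xF yF exy kT r z zF zx zy; apply: NNPP => /eqP ne; apply: stuck.
  exists (swap phi x y); first exact: reach_leq r.
  split; first by rewrite ffunE eq_sym (negPf (Fv _ xF)) eq_sym (negPf (Fv _ yF)).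
  exists z => //; have fz := frF z zF.
  case ezx: (e z x) ne; case ezy: (e z y) => // _.
    by apply: swap_unfrozen; rewrite ?ezy.
  by rewrite swapC; apply: swap_unfrozen; rewrite ?ezx // sym_e.
have twin1 u x : u \in F -> x \in F -> e v u -> e u x -> phi x != b ->
    {in F, forall z, z != u -> z != x -> e z u = e z x}.
  move=> uF xF evu eux xb; apply: (@twinF _ _ 5) => //; first exact: small_leq.
  by apply: (@swap_adjacent _ _ v b) => //; auto.
(* If [u] were a twin of all its neighbours in [F], these would fill [F] by connectivity and make it
   a clique. A neighbour [x] that is not a twin has colour [b], since otherwise [swap_adjacent]
   applies. *)
have exit u : u \in F -> e v u -> exists x,
    [/\ x \in F, e u x, phi x = b, ~~ e v x &
        exists z, [/\ z \in F, z != u, z != x & e z u != e z x]].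
  move=> uF evu; apply: NNPP => none.
  have tw x : x \in F -> e u x -> {in F, forall z, z != u -> z != x -> e z u = e z x}.
    move=> xF eux z zF zu zx; apply: NNPP => /eqP ne; apply: none; exists x.
    have xb : phi x = b.
      by apply/eqP; apply: contraNT ne => xb; rewrite (@twin1 u x).
    split=> //; last by exists z.
    by apply/negP => /nb; rewrite xb eqxx.
  have all_nbr z : z \in F -> (z == u) || e u z.
    move=> zF; have /connectP[p pp ->] := cF _ _ uF zF.
    suff : forall x, path (inside F) x p -> (x == u) || e u x ->
        (last x p == u) || e u (last x p) by apply; rewrite ?eqxx.
    elim: p {pp} => //= y p IH x /andP[/and3P[exy xF yF] pp] h.
    apply: IH => //; have [//|yu] := eqVneq y u.
    case/orP: h => [/eqP<- //|eux].
    have [yx|yx] := eqVneq y x; first by rewrite yx irr_e in exy.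
    by rewrite sym_e (tw x) // sym_e.
  case: nclique => x [y [xF yF xy /negP]]; apply.
  case/orP: (all_nbr _ xF) => [/eqP xu|eux].
    by move: (all_nbr _ yF) xy; rewrite xu eq_sym => /orP[->|].
  case/orP: (all_nbr _ yF) => [/eqP->|euy]; first by rewrite sym_e.
  have [xu|xu] := eqVneq y u; first by rewrite xu irr_e in euy.
  by rewrite sym_e -(tw x) // ?(sym_e y) // eq_sym.
(* Two different colours here would let [swap_detour2] swap one of two pairs that are not twins. *)
have mono u u' : u \in F -> u' \in F -> e v u -> e v u' -> phi u = phi u'.
  move=> uF uF' evu evu'; have [x [xF eux xb evx [z [zF zu zx ne]]]] := exit u uF evu.
  have [x' [xF' eux' xb' evx' [z' [zF' zu' zx' ne']]]] := exit u' uF' evu'.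
  apply/eqP; apply: contraNT ne => uu'.
  case: (@swap_detour2 S phi v b u x u' x') => //.
  - by rewrite !FS ?Fv // evu eux.
  - by split=> //; apply: frF.
  - by rewrite !FS ?Fv // evu' eux'.
  - by split=> //; apply: frF.
  - by move=> r; apply/eqP; apply: (twinF _ _ _ uF xF eux _ r) => //; apply: small_leq.
  - move=> r; case/eqP: ne'; apply: (twinF _ _ _ uF' xF' eux' _ r) => //; exact: small_leq.
have [d [d0 dpar dlip dT]] := distance_in vS cS.
have dv : d v = 0 by apply/eqP; rewrite d0.
have dpos z : z \in F -> 0 < d z by move=> zF; rewrite lt0n d0 ?FS // Fv.
have d1 z : z \in F -> (d z == 1) = e v z.
  move=> zF; apply/eqP/idP => [dz|evz].
    have [t [tS etz]] := dpar _ (FS _ zF) (Fv _ zF).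
    by rewrite dz => -[/esym/eqP]; rewrite d0 // => /eqP <-.
  by apply/eqP; rewrite eqn_leq dpos // andbT -dv; apply: dlip => //; apply: FS.
pose geod := [rel t z | e t z && (d z == (d t).+1)].
have geod_size x p : path geod x p -> d (last x p) = d x + size p.
  elim: p x => [|y p IH] x /=; first by rewrite addn0.
  by case/andP=> /andP[_ /eqP dy] /IH->; rewrite dy addSnnS.
have geod_lt x p t : path geod x p -> t \in x :: p -> t = last x p \/ d t < d (last x p).
  elim: p x => [|y p IH] x /=; first by rewrite inE => _ /eqP; left.
  case/andP=> /andP[_ /eqP dy] pp; rewrite inE => /orP[/eqP->|/(IH _ pp)//].
  by right; rewrite (geod_size _ _ pp) dy addSn ltnS leq_addr.
have geod_to z : z \in F -> exists p, [/\ path geod v p, all (mem F) p & last v p = z].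
  move: {2}(d z) (erefl (d z)) => i; elim: i z => [|i IH] z dz zF.
    by have := dpos _ zF; rewrite dz.
  have [t [tS etz dt]] := dpar _ (FS _ zF) (Fv _ zF).
  have [tv|tv] := eqVneq t v.
    by exists [:: z]; rewrite /= -tv etz dt eqxx zF.
  have tF := SF _ tS tv; have [|p [pp pF lp]] := IH t _ tF; first by case: dt; rewrite dz => -[].
  exists (rcons p z); split; last by rewrite last_rcons.
    by rewrite rcons_path pp lp /= etz dt eqxx.
  by rewrite all_rcons pF andbT.
have twin2 q s x y : path geod v (q ++ [:: s; x]) -> all (mem F) (q ++ [:: s; x]) ->
    y \in F -> e x y -> all (fun t => ~~ e t y) (v :: q) -> phi y != phi (last v q) ->
    {in F, forall z, z != x -> z != y -> e z x = e z y}.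
  move=> pq qF yF exy ny yl.
  have xF : x \in F by apply: (allP qF); rewrite mem_cat !inE eqxx !orbT.
  apply: (@twinF _ _ ((size q).*2 + 7)) => //.
    rewrite leq_add2r leq_double; have := geod_size _ _ pq; rewrite last_cat /= dv.
    move=> dx; have := dT _ (FS _ xF); rewrite dx size_cat /= => /ltnW.
    by apply: leq_trans; rewrite add0n leq_addr.
  apply: (@swap_along S d q phi v b s x y) => //.
  - by apply/and3P; split=> //; [apply: FS | apply/allP => t /(allP qF) /FS].
  - by apply/andP; split; [apply: frF | apply/allP => t /(allP qF) /frF].
(* A second neighbour [q] of [u] would be a twin of both [u] and [x], while some [y] is adjacent to
   [x] but not to [u]. *)
have pendant u : u \in F -> e v u -> exists x, forall q, q \in F -> e u q -> q = x.
  move=> uF evu; have [x [xF eux xb evx [z [zF zu zx ne]]]] := exit u uF evu.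
  have du : d u = 1 by apply/eqP; rewrite d1.
  have dx : d x = 2.
    apply/eqP; rewrite eqn_leq -{1}du dlip ?FS //= ltn_neqAle dpos // andbT eq_sym d1 //.
  have exu : e x u by rewrite sym_e.
  have pvx : path geod v ([::] ++ [:: u; x]) by rewrite /= evu eux dv du dx.
  have aF : all (mem F) ([::] ++ [:: u; x]) by rewrite /= uF xF.
  have twx y : y \in F -> e x y -> ~~ e v y -> phi y != phi v ->
      {in F, forall z, z != x -> z != y -> e z x = e z y}.
    by move=> yF exy evy yv; apply: (twin2 [::] u); rewrite //= evy.
  have [y [yF exy yu euy]] : exists y, [/\ y \in F, e x y, y != u & ~~ e u y].
    move: ne; case ezu: (e z u); case ezx: (e z x) => // _; last first.
      by exists z; split; rewrite // sym_e ?ezx ?ezu.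
    have zb : phi z != b.
      by rewrite -xb; apply: contraNneq zx => /(rb u _ _ uF _ eux) ->//; rewrite sym_e.
    have := twin1 u z uF zF evu _ zb x xF; rewrite sym_e ezu => /(_ isT).
    by rewrite sym_e eux eq_sym (irr _ _ eux) eq_sym zx => /(_ isT isT); rewrite sym_e ezx.
  have evy : ~~ e v y.
    by apply: contraNN yu => /(mono _ _ yF uF)/(_ evu) /(rb x _ _ xF exy exu) ->.
  have xu := irr _ _ exu.
  exists x => q qF euq; apply/eqP; apply: contraT => qx.
  have qb : phi q != b by rewrite -xb; apply: contraNneq qx => /(rb u _ _ uF euq eux) ->.
  have qu : q != u by rewrite eq_sym irr.
  have tuq := twin1 u q uF qF evu euq qb.
  have evq : ~~ e v q.
    apply/negP => evq; have [] := LcolP _ cphi => /(_ _ _ euq) /eqP ne' _.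
    by apply: ne'; apply: mono.
  have exq : e x q by rewrite -(tuq x) // eq_sym.
  have euv : e u v by rewrite sym_e.
  have qv : phi q != phi v by apply: contraNneq (Fv _ qF) => /(rb u _ _ uF euq euv) ->.
  have qy : y != q by apply: contraNneq euy => ->.
  move: euy; rewrite sym_e (tuq y) // -(twx q qF exq evq qv y) // 1?eq_sym ?irr //.
  by rewrite sym_e exy.
(* So F is a path hanging off v, or v |: F is a cycle. *)
have one_child i z : z \in F -> d z = i -> exists t, [/\ t \in S, e t z, (d t).+1 = i &
    {in F &, forall y y', e z y -> e z y' -> y != t -> y' != t -> y = y'}].
  elim/ltn_ind: i z => i IH z zF dz.
  have [i1|i1] := eqVneq i 1.
    have evz : e v z by rewrite -d1 // dz i1.
    exists v; split=> //; first by rewrite dv i1.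
    move=> y y' yF yF' ezy ezy' _ _; have [x nx] := pendant z zF evz.
    by rewrite (nx y) // (nx y').
  have [p [pp pF lp]] := geod_to z zF; have := geod_size _ _ pp.
  rewrite lp dz dv add0n => ip; have i0 : 0 < i by rewrite -dz dpos.
  case/lastP: p => [|p x] in pp pF lp ip *; first by rewrite ip in i0.
  case/lastP: p => [|q s] in pp pF lp ip *; first by rewrite ip in i1.
  move: lp pp pF ip; rewrite last_rcons => ->; rewrite -!cats1 -catA => pq qF iq.
  have := pq; rewrite cat_path /= => /and3P[pq0 /andP[els /eqP ds] /andP[/andP[esz /eqP dsz] _]].
  have sF : s \in F by apply: (allP qF); rewrite mem_cat !inE eqxx orbT.
  set l := last v q in els ds; have lS : l \in S.
    have := mem_last v q; rewrite -/l inE => /orP[/eqP->//|lq].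
    by apply/FS/(allP qF); rewrite mem_cat lq.
  have es : e z s by rewrite sym_e.
  have dl : i = (d l).+2 by rewrite -dz dsz ds.
  exists s; split; [exact: FS|by []|by rewrite ds dl|].
  have below y : y \in F -> e z y -> d z <= (d y).+1.
    by move=> yF ezy; apply: dlip; rewrite ?FS // sym_e.
  suff col y : y \in F -> e z y -> y != s -> phi y = phi l.
    by move=> y y' yF yF' ezy ezy' ys ys'; apply: (rb z) => //; rewrite !col.
  move=> yF ezy ys; apply/eqP; apply: contraT => yl.
  have ly : d l < d y by have := below y yF ezy; rewrite dz dl ltnS.
  have ely : ~~ e l y.
    apply/negP => ely; case/negP: ys; apply/eqP.
    have [lv|lv] := eqVneq l v.
      by apply: (rb z) => //; apply: mono => //; rewrite -lv.
    have [|t [_ _ dt]] := IH (d l) _ l (SF _ lS lv) (erefl _); first by rewrite dl ltnS leqnSn.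
    have ne y' : d l < d y' -> y' != t.
      by apply: contraTneq => ->; rewrite -dt -leqNgt.
    by apply=> //; apply: ne => //; rewrite ds.
  have nly : all (fun t => ~~ e t y) (v :: q).
    apply/allP => t tq; have [->//|lt] := geod_lt _ _ _ pq0 tq.
    have tS : t \in S.
      by move: tq; rewrite inE => /orP[/eqP->//|tq]; apply/FS/(allP qF); rewrite mem_cat tq.
    apply/negP => /(dlip _ _ tS (FS _ yF)); rewrite leqNgt => /negP; apply.
    exact: leq_ltn_trans ly.
  have esy : ~~ e s y.
    apply/negP => esy.
    have [|t [_ _ dt inj]] := IH (d s) _ s sF (erefl _); first by rewrite ds dl.
    have ne y' : d l < d y' -> y' != t.
      by apply: contraTneq => ->; move: dt; rewrite ds => -[->]; rewrite ltnn.
    have := irr _ _ ezy; case/eqP; apply: inj => //; apply: ne => //.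
    by rewrite dz dl leqnSn.
  have := twin2 q s z y pq qF yF ezy nly yl s sF.
  by rewrite esz (negPf esy) (irr _ _ esz) eq_sym ys => /(_ isT isT).
have [t [tS etw dt inj]] := one_child (d w) w wF (erefl _).
have tN : t \in [set z in S | e w z] by rewrite inE tS sym_e.
move: deg3; rewrite (cardsD1 t) tN add1n ltnS => /card_gt1P[y [y' []]].
rewrite !inE => /and3P[yt yS ewy] /and3P[yt' yS' ewy'] /eqP; apply.
have inF z : z != t -> z \in S -> e w z -> z \in F.
  move=> zt zS ewz; apply: SF => //; apply: contraNneq zt => zv.
  have /eqP dw : d w == 1 by rewrite d1 // -zv sym_e.
  by rewrite zv eq_sym -d0 //; move: dt; rewrite dw => -[->].
by apply: inj => //; apply: inF; rewrite ?inE.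
Qed.

(** * Peeling off vertices, and the quadratic bound *)

Lemma clique_frozen F phi psi : {in F &, forall x y, x != y -> e x y} ->
  Lc phi -> Lc psi -> (forall z, z \notin F -> phi z = psi z) ->
  {in F, forall z, frozen phi z} -> {in F, forall z, frozen psi z}.
Proof.
move=> cl cphi cpsi off fr y yF; have [pr li] := LcolP _ cpsi; have [_ li'] := LcolP _ cphi.
(* If [psi x] is not [phi x], a neighbour of [x] had it under [phi]; that neighbour lies in [F], as
   nothing changes outside. Since [psi] is injective on the clique [F], both colourings use the same
   palette there. *)
have col x : x \in F -> psi x \in [seq phi z | z <- enum F].
  move=> xF; have [->|ne] := eqVneq (psi x) (phi x); first by rewrite map_f ?mem_enum.
  have [u exu uE] := frozen_nbr (fr x xF) (li x) ne; rewrite -uE map_f // mem_enum.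
  by apply: contraT => uF; have := pr _ _ exu; rewrite -(off _ uF) uE eqxx.
have [_ same] : (size [seq psi z | z <- enum F] = size [seq phi z | z <- enum F]) *
    ([seq psi z | z <- enum F] =i [seq phi z | z <- enum F]).
  apply: uniq_min_size; last by rewrite !size_map.
    rewrite map_inj_in_uniq ?enum_uniq // => x z; rewrite !mem_enum => xF zF E.
    by apply/eqP; apply: contraT => xz; have := pr _ _ (cl _ _ xF zF xz); rewrite E eqxx.
  by move=> m /mapP[x]; rewrite mem_enum => xF ->; apply: col.
apply/allP => m mL; apply/implyP => my.
have [t tE [tF|eyt]] : exists2 t, phi t = m & t \in F \/ e y t.
- have [->|ne] := eqVneq m (phi y); first by exists y => //; left.
  by have [t ey tE] := frozen_nbr (fr y yF) mL ne; exists t => //; right.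
- have : m \in [seq psi z | z <- enum F] by rewrite same -tE map_f ?mem_enum.
  case/mapP => u; rewrite mem_enum => uF mE; apply/existsP; exists u.
  by rewrite mE eqxx andbT cl //; apply: contraNneq my => ->; rewrite mE.
have [tF|tF] := boolP (t \in F); last first.
  by apply/existsP; exists t; rewrite eyt -off // tE eqxx.
have : m \in [seq psi z | z <- enum F] by rewrite same -tE map_f ?mem_enum.
case/mapP => u; rewrite mem_enum => uF mE; apply/existsP; exists u.
by rewrite mE eqxx andbT cl //; apply: contraNneq my => ->; rewrite mE.
Qed.

(** The token walks to [v], which then takes its final colour. If afterwards only [v] is unfrozen in
    [S], the rest is no clique, for [clique_frozen] would freeze it under [psi] too; so [unlock]
    applies. *)
Lemma peel S v w phi psi : Lc phi -> Lc psi -> v \in S -> w \in S :\ v ->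
  connected_in S -> connected_in (S :\ v) ->
  3 <= #|[set z in S | e w z]| \/ {in S :\ v &, forall x y, x != y -> e x y} ->
  (forall z, z \notin S -> phi z = psi z) ->
  (exists2 y, y \in S & ~~ frozen phi y) -> (exists2 y, y \in S :\ v & ~~ frozen psi y) ->
  exists2 phi', reach S (21 * #|T|) phi phi' &
    (forall z, z \notin S :\ v -> phi' z = psi z) /\
    exists2 y, y \in S :\ v & ~~ frozen phi' y.
Proof.
move=> cphi cpsi vS wF cS cF shape off unf [y yF fy].
have T0 : 0 < #|T| by apply/card_gt0P; exists v.
have [_ lipsi] := LcolP _ cpsi; have [prpsi _] := LcolP _ cpsi.
have [x xS fx] := unf; have [p [pp pS lp sp]] := connected_in_path cS xS vS.
have [phi1 r1] := move_token cphi xS pS pp fx; rewrite lp => f1.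
have c1 := reach_Lcol r1 cphi.
have out u : e v u -> phi1 u = psi v -> u \in S.
  move=> evu; apply: contra_eqT => uS; rewrite (reach_off r1 uS) off // eq_sym.
  exact: prpsi.
have [phi2 r2 v2] := recolour_unfrozen c1 cF vS (lipsi v) out f1 (max_card _).
have r12 := reach_trans r1 r2; have c2 := reach_Lcol r12 cphi.
have off2 z : z \notin S :\ v -> phi2 z = psi z.
  rewrite !inE negb_and negbK => /orP[/eqP->//|zS].
  by rewrite (reach_off r12 zS) off.
(* With [n = #|T|], the walk costs at most [n], recolouring [v] costs [3n + 8] and unlocking
   [2n + 7]; the sum [6n + 15] is at most [21n]. *)
have bound k : k <= #|T|.*2 + 7 -> size p + (#|T|.*2 + (#|T| + 8)) + k <= 21 * #|T|.
  move=> kb; apply: leq_trans (leq_add (leq_add (ltnW sp) (leqnn _)) kb) _.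
  by move: T0; clear; lia.
have [/existsP[z /andP[zF fz]]|/existsPn frz] := boolP [exists z in S :\ v, ~~ frozen phi2 z].
  exists phi2; last by split=> //; exists z.
  by apply: reach_leq r12; rewrite -[X in X <= _]addn0; apply: bound.
have {}frz : {in S :\ v, forall z, frozen phi2 z}.
  by move=> z zF; have := frz z; rewrite zF negbK.
have fv : ~~ frozen phi2 v.
  have [z zS] := reach_unfrozen cphi r12 unf; apply: contraNN => fv.
  have [->//|zv] := eqVneq z v; by apply: frz; rewrite !inE zv.
have nclique : ~ {in S :\ v &, forall x y, x != y -> e x y}.
  by move=> cl; move/negP: fy; apply; apply: (clique_frozen cl c2 cpsi off2 frz).
have deg3 : 3 <= #|[set z in S | e w z]| by case: shape.
have nonadj : exists a b, [/\ a \in S :\ v, b \in S :\ v, a != b & ~~ e a b].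
  apply: NNPP => none; apply: nclique => a b aF bF ab; apply: contraT => eab.
  by case: none; exists a, b.
have SE : v |: (S :\ v) = S by rewrite setD1K.
have [|||phi3 r3 [v3 ex3]] := @unlock (S :\ v) v w phi2 c2 _ frz fv _ cF nonadj wF _.
- by rewrite !inE eqxx.
- by rewrite SE.
- by rewrite SE.
rewrite SE in r3; exists phi3; last split=> //.
  by apply: reach_leq (reach_trans r12 r3); apply: bound.
move=> z zF; have [->|zv] := eqVneq z v; first by rewrite v3.
rewrite (reach_off r3) ?off2 //; by move: zF; rewrite !inE zv.
Qed.

Lemma rooted_connected S w (d : T -> nat) : w \in S ->
  (forall z, z \in S -> z != w -> exists t, [/\ t \in S, e t z & d z = (d t).+1]) ->
  connected_in S.
Proof.
move=> wS par.
have symS : connect_sym (inside S).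
  by apply: sym_connect_sym => x y; rewrite /inside /= sym_e [(y \in S) && _]andbC.
have fromw z : z \in S -> connect (inside S) w z.
  move: {2}(d z) (erefl (d z)) => i; elim/ltn_ind: i z => i IH z dz zS.
  have [->|zw] := eqVneq z w; first exact: connect0.
  have [t [tS etz dt]] := par z zS zw.
  apply: (connect_trans (IH (d t) _ t (erefl _) tS)); first by rewrite -dz dt.
  by apply: connect1; rewrite /inside /= etz tS.
by move=> x y xS yS; apply: (connect_trans _ (fromw _ yS)); rewrite symS fromw.
Qed.

(** A vertex [v] of [S] farthest from [w] is removed, so parents survive. If [v] is adjacent to [w],
    so is all the rest of [S]; if not, [w] loses no neighbour. This maintains the alternative about
    [w]. *)
Lemma reach_by_peeling (d : T -> nat) w psi m S phi : #|S| = m.+1 -> w \in S ->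
  (forall z, (d z == 0) = (z == w)) -> (forall z t, e z t -> d t <= (d z).+1) ->
  (forall z, z \in S -> z != w -> exists t, [/\ t \in S, e t z & d z = (d t).+1]) ->
  3 <= #|[set z in S | e w z]| \/ (forall z, z \in S -> z != w -> e w z) ->
  Lc phi -> Lc psi -> ~~ frozen psi w -> (forall z, z \notin S -> phi z = psi z) ->
  (exists2 y, y \in S & ~~ frozen phi y) ->
  reach setT (m * (21 * #|T|) + 1) phi psi.
Proof.
move=> + + d0 dlip; elim: m S phi => [|m IH] S phi cardS wS par shape cphi cpsi fw off unf.
  have Sw z : z != w -> z \notin S.
    move: cardS => /eqP/cards1P[x Sx]; move: wS; rewrite Sx !inE => /eqP->.
    by [].
  have -> : psi = upd phi w (psi w).
    by apply/ffunP => z; rewrite ffunE; case: eqP => [->//|/eqP /Sw zS]; rewrite off.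
  apply: reach_one; rewrite ?inE //; have [pr li] := LcolP _ cpsi.
  apply/availP; split=> // z ez; rewrite off; first by rewrite eq_sym pr.
  by apply: Sw; apply: contraTneq ez => ->; rewrite irr_e.
pose v := [arg max_(z > w in S) d z].
have [vS vmax] : v \in S /\ forall z, z \in S -> d z <= d v by rewrite /v; case: arg_maxnP.
have [x xS xw] : exists2 x, x \in S & x != w.
  have /card_gt1P[a [b [aS bS ab]]] : 1 < #|S| by rewrite cardS.
  by have [aw|aw] := eqVneq a w; [exists b; rewrite // -aw eq_sym | exists a].
have vw : v != w.
  by rewrite -d0 -lt0n; apply: leq_trans (vmax _ xS); rewrite lt0n d0.
have wF : w \in S :\ v by rewrite !inE eq_sym vw.
have par' z : z \in S :\ v -> z != w ->
    exists t, [/\ t \in S :\ v, e t z & d z = (d t).+1].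
  move=> /setD1P[zv zS] zw; have [t [tS etz dt]] := par z zS zw.
  exists t; rewrite !inE tS andbT; split=> //; apply: contraTneq (vmax _ zS) => <-.
  by rewrite dt ltnn.
have cS := rooted_connected wS par; have cF := rooted_connected wF par'.
(* If [w] is adjacent to all the rest and has at most two neighbours, at most two vertices remain
   without [v]. *)
have clique : 3 <= #|[set z in S | e w z]| \/ {in S :\ v &, forall x y, x != y -> e x y}.
  case: shape => [|all_w]; first by left.
  have [|small] := leqP 3 #|[set z in S | e w z]|; first by left.
  right=> a b /setD1P[av aS] /setD1P[bv bS] ab.
  have [aw|aw] := eqVneq a w; first by rewrite aw all_w // -aw eq_sym.
  have [bw|bw] := eqVneq b w; first by rewrite bw sym_e all_w.
  have : v |: [set a; b] \subset [set z in S | e w z].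
    by apply/subsetP => z; rewrite !inE => /or3P[] /eqP->; rewrite ?vS ?aS ?bS all_w.
  move/subset_leq_card; rewrite leqNgt cardsU1 cards2 !inE (eq_sym v a) (eq_sym v b).
  by rewrite (negPf av) (negPf bv) ab small.
have [phi1 r [off1 unf1]] :=
  peel cphi cpsi vS wF cS cF clique off unf (ex_intro2 _ _ w wF fw).
rewrite mulSn -addnA; apply: reach_trans (reach_sub (subsetT _) r) _.
apply: (IH (S :\ v)) => //; last exact: reach_Lcol r cphi.
  by move: cardS; rewrite (cardsD1 v) vS => -[].
have [evw|evw] := boolP (e w v).
  right=> z /setD1P[zv zS] zw; have [t [tS etz dt]] := par z zS zw.
  have d1 : d v <= 1.
    by have := dlip _ _ evw; have /eqP -> : d w == 0 by rewrite d0.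
  suff /eqP <- : t == w by [].
  by rewrite -d0 -leqn0 -ltnS -dt; apply: leq_trans d1; apply: vmax.
case: shape => [h|all_w]; last by rewrite all_w in evw.
left; apply: leq_trans h _; apply/subset_leq_card/subsetP => z.
by rewrite !inE => /andP[-> ewz]; rewrite ewz !andbT; apply: contraTneq ewz => ->.
Qed.

(** Void steps are dropped; after a genuine step the recoloured vertex can go back, so the colouring
    is unfrozen. *)
Lemma reach_walk S k phi psi : reach S k phi psi -> Lc phi -> unfrozen_col e L phi ->
  unfrozen_walk_within e L k phi psi.
Proof.
elim=> [k1 phi1|k1 phi1 y c psi1 yS av _ IH] cphi uphi.
  by exists [::]; rewrite /= uphi.
have c1 := upd_Lcol cphi av.
have [cy|cy] := eqVneq c (phi1 y).
  rewrite cy upd_id in IH; have [s [? ? ? ?]] := IH cphi uphi.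
  by exists s; split=> //; apply: leqW.
have u1 : unfrozen_col e L (upd phi1 y c).
  rewrite /unfrozen_col c1; apply/existsP; exists y.
  by apply: (unfrozenI (avail_undo y c cphi)); rewrite ffunE eqxx eq_sym.
have [s [us ps ls ss]] := IH c1 u1.
exists (upd phi1 y c :: s); split=> //; first by rewrite /= uphi; exact: us.
rewrite /= ps andbT /recol_step cphi c1 /=; apply/cards1P; exists y.
by apply/setP => z; rewrite !inE ffunE; case: (z =P y) => [->|_]; rewrite ?eqxx // eq_sym.
Qed.

Lemma unfrozen_walk_quadratic phi psi : connected_graph e -> 3 <= maxdeg e ->
  unfrozen_col e L phi -> unfrozen_col e L psi ->
  unfrozen_walk_within e L (23 * #|T| ^ 2) phi psi.
Proof.
move=> conn deg3 uphi; have /andP[cphi /existsP[x fx]] := uphi.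
move=> /andP[cpsi /existsP[y fy]].
have cT : connected_in setT.
  by move=> a b _ _; rewrite (@eq_connect _ _ e) // => u u'; rewrite /inside /= !inE !andbT.
have [w degw] : exists w, 3 <= deg e w.
  apply/existsP; apply: contraTT deg3 => /existsPn small; rewrite -ltnNge ltnS.
  by apply/bigmax_leqP => z _; have := small z; rewrite -ltnNge.
(* The target is first modified to make [w] unfrozen; this is undone at the end by [reach_sym]. *)
have [p [pp pT lp sp]] := connected_in_path cT (in_setT y) (in_setT w).
have [psi' r] := move_token cpsi (in_setT y) pT pp fy; rewrite lp => fw.
have cpsi' := reach_Lcol r cpsi.
have [d [d0 dpar dlip _]] := distance_in (in_setT w) cT.
have cardT : #|[set: T]| = #|T|.-1.+1.
  by rewrite cardsT prednK //; apply/card_gt0P; exists w.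
have r' : reach setT (#|T|.-1 * (21 * #|T|) + 1) phi psi'.
  apply: (reach_by_peeling (d := d) cardT (in_setT w)) => //.
  - by move=> z; apply: d0.
  - by move=> z t; apply: dlip.
  - by left; rewrite (_ : [set z in setT | _] = [set z | e w z]) //; apply/setP => z; rewrite !inE.
  - by move=> z; rewrite inE.
  - by exists x.
apply: reach_walk uphi => //; apply: reach_leq (reach_trans r' (reach_sym cpsi r)).
(* With [n = #|T|] and [size p < n], the total [(n - 1) * 21n + 1 + size p] is at most
   [23 * n^2]. *)
move: cardT sp; rewrite cardsT expnS expn1 => -> /=; move: (size p) (#|T|.-1); clear; nia.
Qed.

(** * Counting frozen against unfrozen colourings *)

Lemma swapK (R : Type) (f : {ffun T -> R}) x y : swap (swap f x y) x y = f.
Proof.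
apply/ffunP => z; rewrite !ffunE !eqxx.
case: (y =P x) => [->|yx]; first by case: (z =P x) => [->|].
by case: (z =P x) => [->|] //; case: (z =P y) => [->|].
Qed.

(** Since [x] is frozen, [phi y] lies in [L x] and occurs around [x] on [y] alone; likewise with [x]
    and [y] exchanged. *)
Lemma swap_Lcol phi x y : Lc phi -> (forall z, frozen phi z) -> e x y -> Lc (swap phi x y).
Proof.
move=> cphi fr exy; have [pr li] := LcolP _ cphi.
have rb z t t' : e z t -> e z t' -> phi t = phi t' -> t = t'.
  by have [_ inj] := frozen_Lcol cphi (fr z); apply: inj.
have im z t : e z t -> phi t \in L z by have [im _] := frozen_Lcol cphi (fr z); apply: im.
have eyx : e y x by rewrite sym_e.
have side u v : e u v -> u = x \/ u = y -> swap phi x y u != swap phi x y v.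
  move=> euv; rewrite !ffunE => -[E|E]; subst u.
    rewrite eqxx; have [vx|vx] := eqVneq v x; first by rewrite vx irr_e in euv.
    have [vy|vy] := eqVneq v y; first by rewrite pr.
    by apply: contraNneq vy => /(rb _ _ _ exy euv)->.
  rewrite eqxx; have [yx|yx] := eqVneq y x; first by rewrite yx irr_e in exy.
  have [vx|vx] := eqVneq v x; first by rewrite pr.
  have [vy|vy] := eqVneq v y; first by rewrite vy irr_e in euv.
  by apply: contraNneq vx => /(rb _ _ _ eyx euv)->.
apply/LcolP; split=> [u v euv|v]; last first.
  rewrite ffunE; case: (v =P x) => [->|_]; first exact: im.
  by case: (v =P y) => [->|_]; [apply: im | apply: li].
have [ux|ux] := eqVneq u x; first by apply: side; [|left].
have [uy|uy] := eqVneq u y; first by apply: side; [|right].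
have evu : e v u by rewrite sym_e.
have [vx|vx] := eqVneq v x; first by rewrite eq_sym; apply: side; [|left].
have [vy|vy] := eqVneq v y; first by rewrite eq_sym; apply: side; [|right].
by rewrite !ffunE (negPf ux) (negPf uy) (negPf vx) (negPf vy) pr.
Qed.

Definition touches w (p : T * T) := [|| w == p.1, w == p.2, e w p.1 | e w p.2].

(** Ordered edges with [N[x] <> N[y]]; in a frozen colouring the swap unfreezes the witness [w]. *)
Definition distinguished : {set T * T} := [set p | e p.1 p.2 &&
  [exists w, [&& w != p.1, w != p.2 & e w p.1 != e w p.2]]].

(** Every vertex is a first coordinate: if [u] had the same closed neighbourhood as each of its
    neighbours, connectivity would make [N[u]] the whole of [T], against [large]. *)
Lemma card_distinguished : connected_graph e -> (forall v, (deg e v).+1 < #|T|) ->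
  #|T| <= #|distinguished|.
Proof.
move=> conn large; apply: leq_trans (leq_imset_card fst _).
apply/subset_leq_card/subsetP => u _; apply: contraT => /imsetP none.
have tw x : e u x -> forall w, w != u -> w != x -> e w u = e w x.
  move=> eux w wu wx; apply: NNPP => /eqP ne; apply: none; exists (u, x) => //.
  by rewrite inE /= eux; apply/existsP; exists w; rewrite wu wx.
have all_nbr z : (z == u) || e u z.
  have /connectP[p pp ->] := conn u z.
  suff : forall x, path e x p -> (x == u) || e u x -> (last x p == u) || e u (last x p).
    by apply; rewrite ?eqxx.
  elim: p {pp} => //= y p IH x /andP[exy pp] h.
  apply: IH => //; have [//|yu] := eqVneq y u.
  case/orP: h => [/eqP<- //|eux].
  have [yx|yx] := eqVneq y x; first by rewrite yx irr_e in exy.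
  by rewrite sym_e (tw x) // sym_e.
have := large u; rewrite ltnNge => /negP; case.
rewrite -cardsT (_ : setT = u |: [set v | e u v]); last first.
  by apply/setP => z; rewrite !inE all_nbr.
by rewrite cardsU1 inE irr_e.
Qed.

(** One end lies in [N[w]] and the other is adjacent to it; the doubling accounts for which end it
    is. *)
Lemma card_touching w :
  #|[set p : T * T | e p.1 p.2 && touches w p]| <= ((maxdeg e).+1 * maxdeg e).*2.
Proof.
have degD v : deg e v <= maxdeg e by apply: leq_bigmax.
pose A := [set p : T * T | ((p.1 == w) || e w p.1) && e p.1 p.2].
have cardA : #|A| <= (maxdeg e).+1 * maxdeg e.
  rewrite -sum1_card (eq_bigl (fun p : T * T => (p.1 \in w |: [set v | e w v]) && e p.1 p.2)).
    rewrite -(pair_big_dep (mem (w |: [set v | e w v])) (fun x y => e x y) (fun _ _ => 1)) /=.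
    apply: (@leq_trans (\sum_(x in w |: [set v | e w v]) maxdeg e)).
      by apply: leq_sum => x _; rewrite sum1dep_card; apply: degD.
    by rewrite sum_nat_const leq_mul // cardsU1 inE irr_e ltnS; apply: degD.
  by move=> p; rewrite !inE.
rewrite -addnn; apply: leq_trans (leq_add cardA cardA).
apply: (@leq_trans (#|A| + #|[set (p.2, p.1) | p in A]|)); last first.
  by rewrite leq_add2l leq_imset_card.
apply: leq_trans (leq_card_setU _ _); apply/subset_leq_card/subsetP => -[x y].
rewrite !inE /touches /= => /andP[exy t]; rewrite exy andbT.
have yxA : (y == w) || e w y -> (x, y) \in [set (p.2, p.1) | p in A].
  by move=> h; apply/imsetP; exists (y, x); rewrite // inE /= h sym_e.
case/or4P: t => [/eqP->|/eqP wy|->|ewy]; rewrite ?eqxx ?orbT //.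
  by rewrite yxA ?orbT // wy eqxx.
by rewrite yxA ?orbT // ewy orbT.
Qed.

(** This is why [swap] is polymorphic: the count runs over functions into an ordinal type, the moves
    over functions into [nat]. *)
Lemma as_col_swap (f : {ffun T -> 'I_(colour_bound L)}) x y :
  as_col (swap f x y) = swap (as_col f) x y.
Proof. by apply/ffunP => z; rewrite !ffunE; case: eqP => // _; case: eqP. Qed.

(** Double counting of pairs of a colouring and an edge. For a fixed edge swapping is an involution,
    hence injective; in each resulting pair the edge touches all unfrozen vertices, so one of them
    bounds the number of edges by [card_touching]. *)
Lemma frozen_unfrozen_count : connected_graph e -> (forall v, (deg e v).+1 < #|T|) ->
  num_frozen e L * #|T| <= num_unfrozen e L * ((maxdeg e).+1 * maxdeg e).*2.
Proof.
move=> conn large; rewrite /num_frozen /num_unfrozen.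
set Fz := [set f | _]; set U := [set f : {ffun T -> _} | unfrozen_col e L _].
apply: leq_trans (leq_mul (leqnn _) (card_distinguished conn large)) _.
rewrite -cardsX; pose h q : {ffun T -> 'I_(colour_bound L)} * (T * T) :=
  (swap q.1 q.2.1 q.2.2, q.2).
have h_inj : injective h.
  move=> [f p] [g q] [/= E pq]; subst q; congr (_, _).
  by rewrite -(swapK f p.1 p.2) E swapK.
pose Y := [set q : {ffun T -> 'I_(colour_bound L)} * (T * T) | (q.1 \in U) &&
  (e q.2.1 q.2.2 && [forall w, ~~ frozen (as_col q.1) w ==> touches w q.2])].
rewrite -(card_imset _ h_inj); apply: (@leq_trans #|Y|).
  apply/subset_leq_card/subsetP => q /imsetP[[f [x y]] /setXP[fF pP] ->]; move: fF pP.
  rewrite !inE /= => /andP[cf /forallP fr] /andP[exy /existsP[w /and3P[wx wy ne]]].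
  rewrite /h /= as_col_swap exy /unfrozen_col swap_Lcol //=; apply/andP; split.
    apply/existsP; exists w; case ewx: (e w x) ne; case ewy: (e w y) => // _.
      by apply: swap_unfrozen; rewrite ?ewy.
    by rewrite swapC; apply: swap_unfrozen; rewrite ?ewx // sym_e.
  apply/forallP => z; apply/implyP; apply: contraR.
  rewrite /touches /= !negb_or => /and4P[zx zy ezx ezy].
  have -> : swap (as_col f) x y = upd (upd (as_col f) y (as_col f x)) x (as_col f y).
    by apply/ffunP => t; rewrite !ffunE.
  by rewrite !frozen_upd.
rewrite -sum1_card (eq_bigl (fun q : _ * (T * T) => (q.1 \in U) &&
  (e q.2.1 q.2.2 && [forall w, ~~ frozen (as_col q.1) w ==> touches w q.2]))); last first.
  by move=> q; rewrite inE.
rewrite -(pair_big_dep (mem U) (fun g p => e p.1 p.2 &&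
  [forall w, ~~ frozen (as_col g) w ==> touches w p]) (fun _ _ => 1)) /=.
rewrite -sum_nat_const; apply: leq_sum => g.
rewrite inE => /andP[_ /existsP[w fw]]; apply: leq_trans (card_touching w).
rewrite sum1dep_card; apply/subset_leq_card/subsetP => p; rewrite !inE.
by move=> /andP[-> /forallP/(_ w)/implyP/(_ fw)].
Qed.

End Moves.

(** * Numerical estimates and the limit of the ratio *)

Lemma expn4_gt D : 2 < D -> D.+1 < D ^ 4.
Proof.
move=> D3; have : 3 ^ 3 <= D ^ 3 by rewrite leq_exp2r.
by rewrite (expnS D 3); move: (D ^ 3) D3; clear; nia.
Qed.

Lemma expn4_ge D : 0 < D -> (D.+1 * D).*2 <= 4 * D ^ 4.
Proof.
move=> D0; have : D * D <= D ^ 4 by rewrite -[D * D]/(D ^ 2) leq_pexp2l.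
by move: (D ^ 4) D0; clear; nia.
Qed.

Theorem mainTheorem2 :
  (exists C : nat, 0 < C /\
     forall (T : finType) (e : rel T) (L : T -> {fset nat}),
       good_pair e L ->
       forall phi psi : {ffun T -> nat},
         unfrozen_col e L phi -> unfrozen_col e L psi ->
         unfrozen_walk_within e L (C * #|T| ^ 2) phi psi)
  /\
  (forall (T : nat -> finType) (e : forall k, rel (T k))
          (L : forall k, T k -> {fset nat}),
     (forall k, good_pair (e k) (L k)) ->
     (forall N : nat, exists K, forall k, K <= k -> N <= #|T k|) ->
     (forall eps : rat, (0 < eps)%R -> exists K, forall k, K <= k ->
        ((maxdeg (e k))%:R ^+ 4 <= eps * (#|T k|)%:R)%R) ->
     forall eps : rat, (0 < eps)%R -> exists K, forall k, K <= k ->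
        ((num_frozen (e k) (L k))%:R / (num_unfrozen (e k) (L k))%:R < eps)%R).
Proof.
split.
  exists 23; split=> // T e L [[sym_e irr_e] conn deg3 lists] phi psi uphi upsi.
  exact: unfrozen_walk_quadratic.
move=> T e L good _ small eps eps0.
(* From [D^4 <= eps / 8 * n] follows [4 * D^4 <= eps * n / 2], which leaves room for the strict
   inequality. *)
have [K1 small1] := small (eps / 8%:R)%R (divr_gt0 eps0 (ltr0n _ 8)).
(* The value [1] yields [D^4 <= n], hence [D + 1 < n] as the count requires. *)
have [K2 small2] := small 1%R ltr01.
exists (maxn K1 K2) => k; rewrite geq_max => /andP[/small1 le1 /small2 le2].
have [[sym_e irr_e] conn deg3 lists] := good k.
move: le1 le2; set D := maxdeg (e k); set n := #|T k| => le1 le2.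
have D_n : D ^ 4 <= n by move: le2; rewrite mul1r -natrX ler_nat.
have large v : (deg (e k) v).+1 < n.
  apply: leq_trans D_n; apply: leq_trans (expn4_gt deg3); rewrite !ltnS.
  exact: leq_bigmax.
have D0 : 0 < D by apply: leq_trans deg3.
have n0 : 0 < n by apply: leq_trans D_n; rewrite expn_gt0 D0.
have := frozen_unfrozen_count sym_e irr_e lists conn large.
rewrite -/D -/n; set f := num_frozen _ _; set u := num_unfrozen _ _ => count.
(* A quotient by zero is [0]; in that case [count] forces [f = 0] as well, so the convention hides
   nothing. *)
have [->|u0] := posnP u; first by rewrite invr0 mulr0.
rewrite ltr_pdivrMr ?ltr0n // -(ltr_pM2r (_ : 0 < n%:R)%R) ?ltr0n //.
have le3 : (f%:R * n%:R <= u%:R * (4%:R * D%:R ^+ 4) :> rat)%R.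
  rewrite -natrX -!natrM ler_nat; apply: leq_trans count _.
  by rewrite leq_mul2l expn4_ge ?orbT.
apply: le_lt_trans le3 _; apply: (@le_lt_trans _ _ (u%:R * (4%:R * (eps / 8%:R * n%:R)))%R).
  by rewrite !ler_wpM2l ?ler0n.
have -> : (u%:R * (4%:R * (eps / 8%:R * n%:R)) = (eps * u%:R * n%:R) / 2%:R)%R by field.
have pos : (0 < eps * u%:R * n%:R)%R by rewrite !mulr_gt0 ?ltr0n.
by rewrite ltr_pdivrMr ?ltr0n // ltr_pMr // ltr1n.
Qed.
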